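(* For all integers $\alpha \geq 0$ and $n \geq 0$, $$PD_2\bigl(2^\alpha(8n+7)\bigr) \equiv 0 \pmod{8}.$$
   Context: A partition with designated summands of weight $n$ is an ordinary integer partition of $n$ in which, for each part size that occurs, exactly one of the occurrences (copies) of that part is designated (marked). $PD_2(n)$ denotes the number of partitions with designated summands of weight $n$ in which all parts are odd (with $PD_2(0)=1$); for example $PD_2(4)=5$, counting $3'+1'$, $1'+1+1+1$, $1+1'+1+1$, $1+1+1'+1$, $1+1+1+1'$. Its generating function is $\sum_{n\ge 0} PD_2(n)q^n = \frac{f_4 f_6^2}{f_1 f_3 f_{12}}$, where $f_r = \prod_{m\ge 1}(1-q^{rm})$. *)

(* Defs.v *)
From HB Require Import structures.
From mathcomp Require Import all_boot.

Set Implicit Arguments.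
Unset Strict Implicit.
Unset Printing Implicit Defensive.

Definition is_partition (n : nat) (l : seq nat) : bool :=
  [&& sorted geq l, 0 \notin l & sumn l == n].

(* A pair (k, b) is one copy of the part k; b tells whether this copy is
   designated. The copies of a given part are kept in order, so that the
   position of the designated copy among them is recorded. *)
Definition is_designated_partition (n : nat) (s : seq (nat * bool)) : bool :=
  is_partition n (unzip1 s) &&
  all (fun k => count_mem (k, true) s == 1) (unzip1 s).

Definition is_PD2 (n : nat) (s : seq (nat * bool)) : bool :=
  is_designated_partition n s && all odd (unzip1 s).

Definition natparts (m : nat) (s : seq ('I_m * bool)) : seq (nat * bool) :=
  [seq (val p.1, p.2) | p <- s].

(* A partition of n has at most n parts, all of them at most n, so the bounds
   below only serve to make the type finite: see PD2_count. *)
Definition PD2 (n : nat) : nat :=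
  #|[set s : n.-bseq ('I_n.+1 * bool) | is_PD2 n (natparts s)]|.

Lemma is_PD2_bounds n s : is_PD2 n s ->
  size s <= n /\ all (fun k => k < n.+1) (unzip1 s).
Proof.
case/andP=> /andP[/and3P[_ s0 /eqP <-] _] _; rewrite -(size_map fst s) -/(unzip1 s).
elim: (unzip1 s) s0 => [|k l IHl] //=.
rewrite in_cons negb_or eq_sym -lt0n => /andP[k_gt0 /IHl[sz_l /allP all_l]].
split; first by rewrite -add1n leq_add.
rewrite ltnS leq_addr; apply/allP=> j /all_l; rewrite !ltnS => le_j.
by rewrite (leq_trans le_j) ?leq_addl.
Qed.

Lemma PD2_count n (L : seq (seq (nat * bool))) :
  uniq L -> (forall s, (s \in L) = is_PD2 n s) -> size L = PD2 n.
Proof.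
move=> uL memL; rewrite /PD2 cardE.
set A := enum _.
have inj_np : injective (fun s : n.-bseq ('I_n.+1 * bool) => natparts s).
  move=> s t; rewrite /natparts => eq_st; apply/val_inj/(inj_map _ eq_st).
  by move=> [i b] [j c] [/val_inj -> ->].
rewrite -(size_map (fun s : n.-bseq ('I_n.+1 * bool) => natparts s) A).
apply: perm_size; apply: uniq_perm => //.
  by rewrite map_inj_uniq ?enum_uniq.
move=> s; rewrite memL; apply/idP/mapP => [Ps | [t]]; last first.
  by rewrite mem_enum inE => Pt ->.
have [sz_s /allP all_s] := is_PD2_bounds Ps.
pose u := [seq (inord p.1 : 'I_n.+1, p.2) | p <- s].
have sz_u : size u <= n by rewrite size_map.
have def_s : natparts u = s.
  rewrite /natparts -map_comp -[RHS]map_id; apply/eq_in_map => -[k b] ksb /=.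
  by rewrite inordK // all_s //; apply: (map_f fst ksb).
by exists (Bseq sz_u); rewrite ?mem_enum ?inE /= ?def_s.
Qed.

(* Main.v *)
Require Import Defs.
From HB Require Import structures.
From Stdlib Require Import Setoid Morphisms.
From mathcomp Require Import all_boot all_order all_algebra boolp ring zify.
Set Implicit Arguments.
Unset Strict Implicit.
Unset Printing Implicit Defensive.
Import GRing.Theory.

(** Let [G] be the product over odd [m] of [1 + sum_(c >= 1) c * q ^ (m * c)],
    whose coefficients are the numbers [PD2 n]: a part [m] used [c] times can be
    designated in [c] ways. Write [phi = sum_(n in Z) q ^ (n ^ 2)],
    [psi = sum_(n >= 0) q ^ (n * (n + 1) / 2)] and
    [f = prod_(m >= 1) (1 - q ^ m)].

    Two identities of Gauss ([theta_prod] and [psi_prod]) express [phi (- q)]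
    and [psi] as infinite products, and give
    [G * phi (- q ^ 2) * f (q ^ 12) = psi (q) * psi (q ^ 3)]. The right-hand
    side is a sum over pairs of integers, in which the terms of even and of odd
    exponent can be told apart ([psi_psi3]). Let the even part [U x] and the odd part of a series [x] be the
    series of its coefficients of even and of odd index. Comparing products
    again, [U G = G ^ 2] ([even_pd]): the coefficients of index [2 ^ a * n] in
    [G] are those of [U ^ a G], and these series can be followed modulo 8.

    Call a series even when only even powers of [q] occur in it. Let [B] be the
    odd part of [G], so that [G = G (q ^ 2) ^ 2 + q * B (q ^ 2)].
    The theta quotients show that [B] is even modulo 4, that its odd part is 4
    times a series which is even modulo 2, and that its even part is [h ^ 2]
    modulo 4, for [h = prod_(m >= 1) (1 + q ^ (3 * m))]. Together with
    [x ^ 2 = x (q ^ 2)] modulo 2, this determines modulo 8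
    [U ^ 2 G = G ^ 4 + q * B ^ 2] and
    [U ^ 3 G = G ^ 8 + 6 * q * G ^ 4 * B ^ 2 + q ^ 2 * B ^ 4], and shows that
    [U ^ 4 G = U ^ 2 G]. It is then enough to see that the coefficients of index
    [8 * n + 7] vanish modulo 8 in [G], [U G], [U ^ 2 G] and [U ^ 3 G]. That index
    is reached by taking the odd part three times; each time the series is
    written as one even modulo a small power of 2 times one whose odd part is
    known. Only [U ^ 2 G] needs more, namely a cancellation of two terms
    [4 * h ^ 7], one of which is computed in [odd_h4]. *)

Local Open Scope ring_scope.

(** * Formal power series *)

Record fps (R : Type) := Fps { fps_coef :> nat -> R }.

HB.instance Definition _ (R : Type) := gen_eqMixin (fps R).
HB.instance Definition _ (R : Type) := gen_choiceMixin (fps R).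

Lemma fpsP (R : Type) (f g : fps R) : (forall n, f n = g n) -> f = g.
Proof.
by case: f g => f [g] fg; congr Fps; apply: functional_extensionality_dep.
Qed.

Section Ring.
Variable R : comNzRingType.
Implicit Types f g h : fps R.

Definition fps_add f g := Fps (fun n => f n + g n).
Definition fps_opp f := Fps (fun n => - f n).
Definition fps_zero : fps R := Fps (fun=> 0).
Definition fps_one : fps R := Fps (fun n => (n == 0)%:R).
Definition fps_mul f g := Fps (fun n => \sum_(i < n.+1) f i * g (n - i)%N).

Fact fps_addA : associative fps_add.
Proof. by move=> f g h; apply: fpsP => n /=; rewrite addrA. Qed.

Fact fps_addC : commutative fps_add.
Proof. by move=> f g; apply: fpsP => n /=; rewrite addrC. Qed.

Fact fps_add0 : left_id fps_zero fps_add.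
Proof. by move=> f; apply: fpsP => n /=; rewrite add0r. Qed.

Fact fps_addN : left_inverse fps_zero fps_opp fps_add.
Proof. by move=> f; apply: fpsP => n /=; rewrite addNr. Qed.

HB.instance Definition _ :=
  GRing.isZmodule.Build (fps R) fps_addA fps_addC fps_add0 fps_addN.

(** The first [N] coefficients of a series as a polynomial: a coefficient of a
    product depends on finitely many coefficients of the factors, so the ring
    laws are inherited from polynomials. *)
Definition trunc N f : {poly R} := \poly_(i < N) f i.

Lemma coef_trunc N f i : (i < N)%N -> (trunc N f)`_i = f i.
Proof. by move=> iN; rewrite coef_poly iN. Qed.

Lemma coef_truncM N f g n : (n < N)%N ->
  (trunc N f * trunc N g)`_n = fps_mul f g n.
Proof.
move=> nN; rewrite coefM; apply: eq_bigr => i _.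
by have lt_in := ltn_ord i; rewrite !coef_trunc //; lia.
Qed.

Fact fps_mulC : commutative fps_mul.
Proof.
by move=> f g; apply: fpsP => n; rewrite -!(coef_truncM _ _ (ltnSn n)) mulrC.
Qed.

Fact fps_mulA : associative fps_mul.
Proof.
move=> f g h; apply: fpsP => n.
transitivity ((trunc n.+1 f * (trunc n.+1 g * trunc n.+1 h))`_n).
  rewrite coefM; apply: eq_bigr => i _.
  by have lt_in := ltn_ord i; rewrite coef_trunc // coef_truncM //; lia.
rewrite mulrA coefM; apply: eq_bigr => i _.
by have lt_in := ltn_ord i; rewrite coef_truncM // coef_trunc //; lia.
Qed.

Fact fps_mul1 : left_id fps_one fps_mul.
Proof.
move=> f; apply: fpsP => n /=; rewrite big_ord_recl subn0 mul1r.
by rewrite big1 ?addr0 // => i _; rewrite mul0r.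
Qed.

Fact fps_mulDl : left_distributive fps_mul fps_add.
Proof.
move=> f g h; apply: fpsP => n /=; rewrite -big_split /=.
by apply: eq_bigr => i _; rewrite mulrDl.
Qed.

Fact fps_one_neq0 : fps_one != 0.
Proof.
apply/eqP => /(congr1 (fun f : fps R => f 0%N)) /= /eqP.
by rewrite oner_eq0.
Qed.

HB.instance Definition _ :=
  GRing.Zmodule_isComNzRing.Build (fps R)
    fps_mulA fps_mulC fps_mul1 fps_mulDl fps_one_neq0.

Lemma fpsD f g n : (f + g) n = f n + g n. Proof. by []. Qed.
Lemma fpsN f n : (- f) n = - f n. Proof. by []. Qed.
Lemma fpsB f g n : (f - g) n = f n - g n. Proof. by []. Qed.
Lemma fps1 n : (1 : fps R) n = (n == 0)%:R. Proof. by []. Qed.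
Lemma fpsM f g n : (f * g) n = \sum_(i < n.+1) f i * g (n - i)%N.
Proof. by []. Qed.

Lemma fps_sum I (r : seq I) (P : pred I) (F : I -> fps R) n :
  (\sum_(i <- r | P i) F i) n = \sum_(i <- r | P i) F i n.
Proof. by elim/big_rec2: _ => // i x y _ <-. Qed.

Lemma fpsMn f k n : (f *+ k) n = f n *+ k.
Proof. by elim: k => [|k IHk] //; rewrite !mulrS fpsD IHk. Qed.

Lemma fpsMnat k f n : (k%:R * f) n = k%:R * f n.
Proof. by rewrite !mulr_natl fpsMn. Qed.

Lemma fpsM0 f g : (f * g) 0%N = f 0%N * g 0%N.
Proof. by rewrite fpsM big_ord1. Qed.

Lemma fpsX0 f k : (f ^+ k) 0%N = f 0%N ^+ k.
Proof. by elim: k => [|k IHk] //; rewrite !exprS fpsM0 IHk. Qed.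

(** The coefficients of [f] are determined one after the other by those of
    [h * f]. *)
Lemma fps_mulIr f g h : h 0%N = 1 -> h * f = h * g -> f = g.
Proof.
move=> h0 hfg; apply: fpsP => n; elim/ltn_ind: n => n IHn.
have := congr1 (fun f : fps R => f n) hfg.
rewrite !fpsM !big_ord_recl h0 !subn0 !mul1r => /eqP.
have -> : \sum_(i < n) h (lift ord0 i) * f (n - lift ord0 i)%N =
          \sum_(i < n) h (lift ord0 i) * g (n - lift ord0 i)%N.
  by apply: eq_bigr => i _; have lt_in := ltn_ord i; rewrite IHn // /= /bump;
    lia.
by rewrite (inj_eq (addIr _)) => /eqP.
Qed.

Definition q : fps R := Fps (fun n => (n == 1)%:R).

Lemma qM f n : (q * f) n = if n is m.+1 then f m else 0.
Proof.
rewrite fpsM big_ord_recl mul0r add0r; case: n => [|n];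
  first by rewrite big_ord0.
rewrite big_ord_recl /= mul1r subSS subn0 big1 ?addr0 // => i _.
by rewrite mul0r.
Qed.

Lemma qXM k f n : (q ^+ k * f) n = if (k <= n)%N then f (n - k)%N else 0.
Proof.
elim: k f n => [|k IHk] f n; first by rewrite expr0 mul1r subn0.
by rewrite exprS -mulrA qM; case: n => [|n] //; rewrite IHk.
Qed.

Lemma qX k n : (q ^+ k) n = (n == k)%:R.
Proof.
rewrite -[q ^+ k]mulr1 qXM fps1.
case: leqP => [kn|nk]; first by congr _%:R; lia.
by rewrite (_ : (n == k) = false) //; lia.
Qed.

(** ** Agreement of coefficients below a bound *)

Definition eq_below N f g := forall n, (n < N)%N -> f n = g n.

Lemma eq_belowP f g : (forall N, eq_below N f g) -> f = g.
Proof. by move=> fg; apply: fpsP => n; apply: (fg n.+1). Qed.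

Lemma eq_below_refl N f : eq_below N f f. Proof. by []. Qed.

Lemma eq_below_sym N f g : eq_below N f g -> eq_below N g f.
Proof. by move=> fg n nN; rewrite fg. Qed.

Lemma eq_below_trans N f g h :
  eq_below N f g -> eq_below N g h -> eq_below N f h.
Proof. by move=> fg gh n nN; rewrite fg ?gh. Qed.

Lemma eq_belowD N f f' g g' :
  eq_below N f f' -> eq_below N g g' -> eq_below N (f + g) (f' + g').
Proof. by move=> ff gg n nN; rewrite !fpsD ff ?gg. Qed.

Lemma eq_belowM N f f' g g' :
  eq_below N f f' -> eq_below N g g' -> eq_below N (f * g) (f' * g').
Proof.
move=> ff gg n nN; rewrite !fpsM; apply: eq_bigr => i _.
by have lt_in := ltn_ord i; rewrite ff ?gg //; lia.
Qed.

Lemma eq_below_prod1 N I (r : seq I) (P : pred I) (F : I -> fps R) :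
  (forall i, P i -> eq_below N (F i) 1) ->
  eq_below N (\prod_(i <- r | P i) F i) 1.
Proof.
move=> F1; elim/big_rec: _ => [|i f Pi f1]; first exact: eq_below_refl.
by rewrite -[1]mulr1; apply: eq_belowM => //; apply: F1.
Qed.

Lemma eq_below_qXM N k f : (N <= k)%N -> eq_below N (q ^+ k * f) 0.
Proof. by move=> Nk n nN; rewrite qXM ifN //; lia. Qed.

Lemma eq_below_qX N k : (N <= k)%N -> eq_below N (q ^+ k) 0.
Proof. by move=> Nk; rewrite -[q ^+ k]mulr1; apply: eq_below_qXM. Qed.

(** ** Infinite products and sums *)

(** The [n]-th coefficients of the [n]-th partial product and sum: these are the
    limits as soon as the later terms do not contribute, which is what
    [multipliable] and [summable] below require. *)
Definition iprod (F : nat -> fps R) : fps R :=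
  Fps (fun n => (\prod_(i < n.+1) F i) n).

Definition isum (F : nat -> fps R) : fps R :=
  Fps (fun n => (\sum_(i < n.+1) F i) n).

Definition multipliable F := forall i, eq_below i.+1 (F i) 1.
Definition summable F := forall i, eq_below i (F i) 0.

Lemma iprod_below F N M : multipliable F -> (N <= M)%N ->
  eq_below N (iprod F) (\prod_(i < M) F i).
Proof.
move=> cF NM n nN; have nM := leq_trans nN NM.
rewrite -(big_mkord xpredT) (big_cat_nat (leq0n _) nM) /= big_mkord.
rewrite -[\prod_(i < n.+1) F i in LHS]mulr1.
apply: (@eq_belowM n.+1) => //; apply: eq_below_sym.
rewrite big_nat; apply: eq_below_prod1 => i /andP[ni _] m mn.
by apply: cF; lia.
Qed.

Lemma isum_below F N M : summable F -> (N <= M)%N ->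
  eq_below N (isum F) (\sum_(i < M) F i).
Proof.
move=> cF NM n nN; have nM := leq_trans nN NM.
rewrite -(big_mkord xpredT) (big_cat_nat (leq0n _) nM) big_mkord.
rewrite fpsD [X in _ + X]fps_sum [X in _ + X]big_nat [X in _ + X]big1 ?addr0 //.
by move=> i /andP[ni _]; apply: cF; lia.
Qed.

Lemma iprod_eq_below F f : multipliable F ->
  (forall N, exists2 M, (N <= M)%N & eq_below N f (\prod_(i < M) F i)) ->
  f = iprod F.
Proof.
move=> cF Ff; apply: eq_belowP => N; have [M NM fM] := Ff N.
by apply: eq_below_trans fM (eq_below_sym (iprod_below cF NM)).
Qed.

Lemma iprod0 F : multipliable F -> (iprod F) 0%N = 1.
Proof. by move=> cF; rewrite /= big_ord1 cF. Qed.

Lemma multipliableM F G : multipliable F -> multipliable G ->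
  multipliable (fun i => F i * G i).
Proof. by move=> cF cG i; rewrite -[1]mulr1; apply: eq_belowM. Qed.

Lemma iprodM F G : multipliable F -> multipliable G ->
  iprod F * iprod G = iprod (fun i => F i * G i).
Proof.
move=> cF cG; apply: iprod_eq_below; first exact: multipliableM.
by move=> N; exists N => //; rewrite big_split; apply: eq_belowM;
  apply: iprod_below.
Qed.

Lemma eq_iprod F G : (forall i, F i = G i) -> iprod F = iprod G.
Proof. by move=> FG; congr iprod; apply: functional_extensionality_dep. Qed.

(** ** Substitution of a power of the variable, and of its opposite *)

Definition subX k f : fps R :=
  Fps (fun n => if (k %| n)%N then f (n %/ k)%N else 0).

Definition subN f : fps R := Fps (fun n => (-1) ^+ n * f n).

Lemma subXD k f g : subX k (f + g) = subX k f + subX k g.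
Proof. by apply: fpsP => n /=; case: ifP; rewrite ?addr0. Qed.

Lemma subXN k f : subX k (- f) = - subX k f.
Proof. by apply: fpsP => n /=; case: ifP; rewrite ?oppr0. Qed.

Lemma subX0 k : subX k 0 = 0.
Proof. by apply: fpsP => n /=; case: ifP. Qed.

Lemma subX1 k : (0 < k)%N -> subX k 1 = 1.
Proof.
move=> k0; apply: fpsP => n /=.
case: ifP => [/dvdnP[m ->]|]; first by rewrite mulnK //
  muln_eq0 [k == 0%N]eqn0Ngt k0 orbF.
by case: n => //; rewrite dvdn0.
Qed.

Lemma subXM k f g : (0 < k)%N -> subX k (f * g) = subX k f * subX k g.
Proof.
move=> k0; apply: fpsP => n.
have tX (h : fps R) m : (m < n.+1)%N ->
  (trunc n.+1 (subX k h))`_m = (trunc n.+1 h \Po 'X^k)`_m.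
  move=> mn; rewrite coef_trunc // coef_comp_poly_Xn //=; case: ifP => // km.
  by rewrite coef_trunc //; apply: leq_ltn_trans (leq_div _ _) mn.
transitivity (((trunc n.+1 f * trunc n.+1 g) \Po 'X^k)`_n).
  rewrite coef_comp_poly_Xn //=; case: ifP => // kn.
  by rewrite coef_truncM //; apply: leq_ltn_trans (leq_div _ _) _.
rewrite comp_polyM coefM fpsM; apply: eq_bigr => i _.
by have lt_in := ltn_ord i; rewrite -!tX ?coef_trunc //; lia.
Qed.

Lemma subXX k f n : (0 < k)%N -> subX k (f ^+ n) = subX k f ^+ n.
Proof.
by move=> k0; elim: n => [|n IHn]; rewrite ?subX1 // !exprS subXM ?IHn.
Qed.

Lemma subXnat k n : (0 < k)%N -> subX k n%:R = n%:R.
Proof.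
by move=> k0; elim: n => [|n IHn]; rewrite ?subX0 // !mulrS subXD subX1 ?IHn.
Qed.

Lemma subXq k : (0 < k)%N -> subX k q = q ^+ k.
Proof.
move=> k0; apply: fpsP => n; rewrite /= qX.
case: ifP => [/dvdnP[m ->]|kn].
  by rewrite mulnK // -{2}[k]mul1n eqn_pmul2r.
by case: eqP kn => // ->; rewrite dvdnn.
Qed.

Lemma subXqX k n : (0 < k)%N -> subX k (q ^+ n) = q ^+ (k * n).
Proof. by move=> k0; rewrite subXX // subXq // exprM. Qed.

Lemma subX_comp j k f : (0 < j)%N -> (0 < k)%N ->
  subX j (subX k f) = subX (j * k) f.
Proof.
move=> j0 k0; apply: fpsP => n /=.
have [/dvdnP[m ->]|jn] := boolP (j %| n)%N.
  by rewrite mulnK // [(j * k)%N]mulnC dvdn_pmul2r // divnMr.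
by rewrite ifN //; apply: contra jn; apply: dvdn_trans (dvdn_mulr _ _).
Qed.

Lemma subX_below N k f g : (0 < k)%N ->
  eq_below N f g -> eq_below N (subX k f) (subX k g).
Proof.
move=> k0 fg n nN /=; case: ifP => // _.
by apply: fg; apply: leq_ltn_trans (leq_div _ _) nN.
Qed.

Lemma subX_prod k I (r : seq I) (F : I -> fps R) : (0 < k)%N ->
  subX k (\prod_(i <- r) F i) = \prod_(i <- r) subX k (F i).
Proof.
move=> k0; elim/big_rec2: _ => [|i x y _ <-]; first exact: subX1.
exact: subXM.
Qed.

Lemma subX_sum k I (r : seq I) (F : I -> fps R) :
  subX k (\sum_(i <- r) F i) = \sum_(i <- r) subX k (F i).
Proof.
elim/big_rec2: _ => [|i x y _ <-]; first exact: subX0.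
exact: subXD.
Qed.

Lemma multipliable_subX k F : (0 < k)%N ->
  multipliable F -> multipliable (fun i => subX k (F i)).
Proof. by move=> k0 cF i; rewrite -(subX1 k0); apply: subX_below. Qed.

Lemma subX_iprod k F : (0 < k)%N -> multipliable F ->
  subX k (iprod F) = iprod (fun i => subX k (F i)).
Proof.
move=> k0 cF; apply: iprod_eq_below; first exact: multipliable_subX.
move=> N; exists N => //; rewrite -subX_prod //.
exact/subX_below/iprod_below.
Qed.

Lemma subX_coef0 k f : subX k f 0%N = f 0%N.
Proof. by rewrite /= dvdn0 div0n. Qed.

Lemma subN_D f g : subN (f + g) = subN f + subN g.
Proof. by apply: fpsP => n /=; rewrite mulrDr. Qed.

Lemma subN_1 : subN 1 = 1.
Proof. by apply: fpsP => -[|n] /=; rewrite ?mulr1 // mulr0. Qed.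

Lemma subN_M f g : subN (f * g) = subN f * subN g.
Proof.
apply: fpsP => n; rewrite /= mulr_sumr; apply: eq_bigr => i _.
by have lt_in := ltn_ord i; rewrite mulrACA -exprD subnKC //; lia.
Qed.

Lemma subN_nat n : subN n%:R = n%:R.
Proof.
elim: n => [|n IHn]; first by apply: fpsP => n; apply: mulr0.
by rewrite !mulrS subN_D subN_1 IHn.
Qed.

Lemma subN_N f : subN (- f) = - subN f.
Proof. by apply: fpsP => n /=; rewrite mulrN. Qed.

Lemma subN_K f : subN (subN f) = f.
Proof.
by apply: fpsP => n /=; rewrite mulrA -exprMn mulrNN mulr1 expr1n mul1r.
Qed.

Lemma subN_below N f g : eq_below N f g -> eq_below N (subN f) (subN g).
Proof. by move=> fg n nN /=; rewrite fg. Qed.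

Lemma subN_qX k : subN (q ^+ k) = (-1) ^+ k * q ^+ k.
Proof.
apply: fpsP => n; have sgn m : (-1) ^+ m * q ^+ k =
  (if odd m then - q ^+ k else q ^+ k).
  by rewrite -signr_odd; case: odd; rewrite ?mul1r // mulN1r.
rewrite sgn /= !qX -signr_odd; case: (eqVneq n k) => [->|nk].
  by case: odd; rewrite ?fpsN qX eqxx ?mulr1.
by rewrite mulr0; case: odd; rewrite ?fpsN qX (negPf nk) ?oppr0.
Qed.

Lemma subN_subX2 f : subN (subX 2 f) = subX 2 f.
Proof.
apply: fpsP => n /=; case: ifP => [n2|]; last by rewrite mulr0.
by rewrite -signr_odd -[odd n]negbK -dvdn2 n2 mul1r.
Qed.

Lemma subN_prod I (r : seq I) (F : I -> fps R) :
  subN (\prod_(i <- r) F i) = \prod_(i <- r) subN (F i).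
Proof.
elim/big_rec2: _ => [|i x y _ <-]; first exact: subN_1.
exact: subN_M.
Qed.

Lemma subN_sum I (r : seq I) (F : I -> fps R) :
  subN (\sum_(i <- r) F i) = \sum_(i <- r) subN (F i).
Proof.
elim/big_rec2: _ => [|i x y _ <-]; first exact: (subN_nat 0).
exact: subN_D.
Qed.

Lemma multipliable_subN F :
  multipliable F -> multipliable (fun i => subN (F i)).
Proof. by move=> cF i; rewrite -subN_1; apply: subN_below. Qed.

Lemma subN_iprod F : multipliable F ->
  subN (iprod F) = iprod (fun i => subN (F i)).
Proof.
move=> cF; apply: iprod_eq_below; first exact: multipliable_subN.
move=> N; exists N => //; rewrite -subN_prod.
exact/subN_below/iprod_below.
Qed.

(** ** Even and odd parts *)

Definition even_part f : fps R := Fps (fun n => f n.*2).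
Definition odd_part f : fps R := Fps (fun n => f n.*2.+1).

Lemma even_part_coef f n : even_part f n = f n.*2. Proof. by []. Qed.
Lemma odd_part_coef f n : odd_part f n = f n.*2.+1. Proof. by []. Qed.

Lemma even_partK f g : even_part (subX 2 f + q * subX 2 g) = f.
Proof.
apply: fpsP => n; rewrite even_part_coef fpsD qM /= dvdn2 odd_double /=.
rewrite -muln2 mulnK //; case: n => [|n]; first by rewrite addr0.
by rewrite muln2 doubleS /= dvdn2 /= odd_double addr0.
Qed.

Lemma odd_partK f g : odd_part (subX 2 f + q * subX 2 g) = g.
Proof.
apply: fpsP => n; rewrite odd_part_coef fpsD qM /= !dvdn2 /= odd_double /=.
by rewrite add0r -muln2 mulnK.
Qed.

Lemma parts_eq f : f = subX 2 (even_part f) + q * subX 2 (odd_part f).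
Proof.
apply: fpsP => n; rewrite fpsD qM; case: n => [|n] /=; first by rewrite addr0.
rewrite !dvdn2 /=; have := odd_double_half n.
case on: (odd n) => /= <-; rewrite ?add0r ?addr0.
  by congr (f _); lia.
by congr (f _); lia.
Qed.

Lemma even_partE f a b : f = subX 2 a + q * subX 2 b -> even_part f = a.
Proof. by move->; apply: even_partK. Qed.

Lemma odd_partE f a b : f = subX 2 a + q * subX 2 b -> odd_part f = b.
Proof. by move->; apply: odd_partK. Qed.

Lemma even_partD f g : even_part (f + g) = even_part f + even_part g.
Proof. exact: fpsP. Qed.

Lemma odd_partD f g : odd_part (f + g) = odd_part f + odd_part g.
Proof. exact: fpsP. Qed.

Lemma even_partMnat k f : even_part (k%:R * f) = k%:R * even_part f.
Proof. by apply: fpsP => n; rewrite fpsMnat /= -fpsMnat. Qed.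

Lemma odd_partMnat k f : odd_part (k%:R * f) = k%:R * odd_part f.
Proof. by apply: fpsP => n; rewrite fpsMnat /= -fpsMnat. Qed.

Lemma even_part_subXM f g : even_part (subX 2 f * g) = f * even_part g.
Proof.
apply: (@even_partE _ _ (f * odd_part g)).
by rewrite {1}[g]parts_eq !subXM //; ring.
Qed.

Lemma odd_part_subXM f g : odd_part (subX 2 f * g) = f * odd_part g.
Proof.
apply: (@odd_partE _ (f * even_part g)).
by rewrite {1}[g]parts_eq !subXM //; ring.
Qed.

Lemma even_part_qM f : even_part (q * f) = q * odd_part f.
Proof.
apply: (@even_partE _ _ (even_part f)).
by rewrite {1}[f]parts_eq !subXM // subXq //; ring.
Qed.

Lemma odd_part_qM f : odd_part (q * f) = even_part f.
Proof.
apply: (@odd_partE _ (q * odd_part f)).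
by rewrite {1}[f]parts_eq !subXM // subXq //; ring.
Qed.

Lemma even_part_subX f : even_part (subX 2 f) = f.
Proof. by apply: (@even_partE _ _ 0); rewrite subX0 mulr0 addr0. Qed.

Lemma odd_part_subX f : odd_part (subX 2 f) = 0.
Proof. by apply: (@odd_partE _ f); rewrite subX0 mulr0 addr0. Qed.

End Ring.

(** * Two identities of Gauss *)

Section Gauss.
Variable R : comNzRingType.
Local Notation q := (q R).

Definition euler_prod := iprod (fun i => 1 - q ^+ i.+1).
Definition distinct_prod := iprod (fun i => 1 + q ^+ i.+1).
Definition odd_prod := iprod (fun i => 1 - q ^+ i.*2.+1).

(** The exponents [k] and [- k] are grouped, so that [theta] is the sum of
    [q ^ (a ^ 2)] over all integers [a]; then [subN theta] is the alternating
    series. *)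
Definition theta_term k := (0 < k).+1%:R * q ^+ (k ^ 2).
Definition theta := isum theta_term.
Definition tri k := 'C(k.+1, 2).
Arguments tri : simpl never.
Definition psi := isum (fun k => q ^+ tri k).

Lemma eq_below_addqX N k (c : fps R) : (N <= k)%N ->
  eq_below N (1 + c * q ^+ k) 1.
Proof.
move=> Nk; rewrite -[X in eq_below _ _ X]addr0; apply: eq_belowD => //.
by rewrite mulrC; apply: eq_below_qXM.
Qed.

Lemma multipliable_euler : multipliable (fun i => 1 - q ^+ i.+1).
Proof. by move=> i; rewrite -mulN1r; apply: eq_below_addqX. Qed.

Lemma multipliable_distinct : multipliable (fun i => 1 + q ^+ i.+1).
Proof. by move=> i; rewrite -[q ^+ _]mul1r; apply: eq_below_addqX. Qed.

Lemma multipliable_odd : multipliable (fun i => 1 - q ^+ i.*2.+1).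
Proof. by move=> i; rewrite -mulN1r; apply: eq_below_addqX; lia. Qed.

Lemma summable_theta : summable theta_term.
Proof. by move=> k; rewrite /theta_term mulrC; apply: eq_below_qXM; nia. Qed.

Lemma triE k : (tri k * 2 = k * k.+1)%N.
Proof. by rewrite /tri muln2 bin2 halfK oddM /= andNb subn0 mulnC. Qed.

Lemma summable_psi : summable (fun k => q ^+ tri k).
Proof. by move=> k; apply: eq_below_qX; have := triE k; nia. Qed.

Lemma euler_coef0 : euler_prod 0%N = 1.
Proof. exact: iprod0 multipliable_euler. Qed.

Lemma odd_coef0 : odd_prod 0%N = 1.
Proof. exact: iprod0 multipliable_odd. Qed.

Lemma odd_euler : odd_prod * subX 2 euler_prod = euler_prod.
Proof.
rewrite /euler_prod subX_iprod //; last exact: multipliable_euler.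
rewrite iprodM; first last.
- by apply: multipliable_subX => //; apply: multipliable_euler.
- exact: multipliable_odd.
apply: esym; apply: iprod_eq_below.
  apply: multipliableM; first exact: multipliable_odd.
  by apply: multipliable_subX => //; apply: multipliable_euler.
move=> N; exists N => //.
rewrite (_ : \prod_(i < N) _ = \prod_(i < N.*2) (1 - q ^+ i.+1)).
  by apply: iprod_below; [apply: multipliable_euler | lia].
elim: N => [|N IHN]; first by rewrite !big_ord0.
rewrite doubleS !big_ord_recr /= IHN subXD subXN subX1 // subXqX //.
by rewrite mulrA (_ : 2 * N.+1 = N.*2.+2)%N //; lia.
Qed.

Lemma distinct_euler : distinct_prod * euler_prod = subX 2 euler_prod.
Proof.
rewrite [X in _ = subX _ X]/euler_prod subX_iprod //;
  last exact: multipliable_euler.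
rewrite iprodM; [|exact: multipliable_distinct|exact: multipliable_euler].
apply: eq_iprod => i; rewrite subXD subXN subX1 // subXqX // mulnC exprM.
by ring.
Qed.

Lemma odd_distinct : odd_prod * distinct_prod = 1.
Proof.
apply: (@fps_mulIr _ _ _ euler_prod); first exact: euler_coef0.
by rewrite mulr1 mulrC -mulrA distinct_euler odd_euler.
Qed.

(** A finite form of the product formula for the alternating theta series, by
    induction on [n]: the summands [t] for [n] and [n + 1] differ, up to the
    factor [1 + q ^ (n + 1)], by a telescoping difference of terms [c]. *)
Lemma theta_finite n :
  \sum_(s < n.+1) (-1) ^+ s * q ^+ (s * n.+1) *
     (\prod_(s.+1 <= i < n.+1) (1 - q ^+ i) * \prod_(i < s) (1 + q ^+ i)) =
  \prod_(i < n) (1 + q ^+ i.+1) * \sum_(s < n.+1) (-1) ^+ s * theta_term s.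
Proof.
pose c n s : fps R := (-1) ^+ s * q ^+ (s * n.+1) *
     (\prod_(s <= i < n.+1) (1 - q ^+ i) * \prod_(i < s) (1 + q ^+ i)).
pose t n s : fps R := (-1) ^+ s * q ^+ (s * n.+1) *
     (\prod_(s.+1 <= i < n.+1) (1 - q ^+ i) * \prod_(i < s) (1 + q ^+ i)).
rewrite -[LHS]/(\sum_(s < n.+1) t n s).
elim: n => [|n IHn].
  rewrite !big_ord1 /t !big_ord0 big_geq // /theta_term.
  by rewrite !expr0 !mulr1.
have step s : (s <= n)%N ->
    t n.+1 s = (1 + q ^+ n.+1) * t n s + (c n s.+1 - c n s).
  move=> sn; rewrite /t /c [\prod_(s <= i < _) _]big_ltn ?ltnS //.
  rewrite [in LHS]big_nat_recr ?ltnS //= big_ord_recr /= [(-1) ^+ s.+1]exprS.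
  rewrite (_ : s * n.+2 = s + s * n.+1)%N; last by lia.
  by rewrite (_ : s.+1 * n.+1 = n.+1 + s * n.+1)%N ?exprD; last lia; ring.
rewrite big_ord_recr /= (eq_bigr (fun s : 'I__ =>
  (1 + q ^+ n.+1) * t n s + (c n s.+1 - c n s))); last first.
  by move=> s _; apply: step; rewrite -ltnS.
rewrite big_split -mulr_sumr IHn /=.
rewrite -(big_mkord xpredT (fun s => c n s.+1 - c n s)) telescope_sumr //.
rewrite [X in _ = _ * X]big_ord_recr [X in _ = X * _]big_ord_recr /=.
(* [c n 0] vanishes, as it contains the factor [1 - q ^ 0]. *)
rewrite {1}/c big_geq // {1}/c [\prod_(0 <= i < _) _]big_ltn //
  expr0 subrr !(mul0r, mulr0) subr0.
rewrite /t big_geq // big_ord_recl /theta_term expr0 /=.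
rewrite (_ : n.+1 ^ 2 = n.+1 * n.+1)%N; last by lia.
rewrite (_ : n.+1 * n.+2 = n.+1 + n.+1 * n.+1)%N ?exprD; last lia.
by rewrite !mul1r; ring.
Qed.

(** As [n] grows, only the summand [s = 0] survives on the left-hand side of
    the finite identity. *)
Lemma theta_prod : distinct_prod * subN theta = euler_prod.
Proof.
apply: eq_belowP => N.
have cN s : (-1) ^+ s * theta_term s = subN (theta_term s).
  rewrite /theta_term subN_M subN_qX subN_nat.
  by rewrite -[in LHS]signr_odd -[in RHS]signr_odd oddX /=; ring.
apply: (@eq_below_trans _ _ _
   (\prod_(i < N) (1 + q ^+ i.+1) * \sum_(s < N.+1) subN (theta_term s))).
  apply: eq_belowM; first by apply: iprod_below => //;
    apply: multipliable_distinct.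
  rewrite -subN_sum; apply: subN_below.
  by apply: isum_below (leqnSn N); apply: summable_theta.
under [X in _ * X]eq_bigr => s _ do rewrite -cN.
rewrite -theta_finite big_ord_recl mul0n !expr0 !mul1r big_ord0 mulr1.
rewrite -[euler_prod]addr0; apply: (@eq_belowD _ N).
  rewrite big_add1 big_mkord; apply: eq_below_sym.
  by apply: iprod_below => //; apply: multipliable_euler.
move=> n nN; rewrite fps_sum big1 // => s _.
rewrite [_ * q ^+ _]mulrC -mulrA; apply: eq_below_qXM nN.
by rewrite /= /bump; nia.
Qed.

(** The same telescoping argument gives the finite form of the product formula
    for the triangular numbers. *)
Lemma psi_finite n :
  \sum_(s < n) q ^+ (s * n.*2.+1) *
     (\prod_(s.+1 <= i < n.+1) (1 - q ^+ i.*2) *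
      \prod_(i < s) (1 - q ^+ i.*2.+1)) =
  \prod_(i < n) (1 - q ^+ i.*2.+1) * \sum_(s < n.*2) q ^+ tri s.
Proof.
pose c n s : fps R := q ^+ (s * n.*2.+1) *
     (\prod_(s <= i < n.+1) (1 - q ^+ i.*2) *
      \prod_(i < s) (1 - q ^+ i.*2.+1)).
pose t n s : fps R := q ^+ (s * n.*2.+1) *
     (\prod_(s.+1 <= i < n.+1) (1 - q ^+ i.*2) *
      \prod_(i < s) (1 - q ^+ i.*2.+1)).
rewrite -[LHS]/(\sum_(s < n) t n s).
elim: n => [|n IHn]; first by rewrite !big_ord0 mulr0.
have step s : (s <= n)%N ->
    t n.+1 s = (1 - q ^+ n.*2.+1) * t n s + (c n s.+1 - c n s).
  move=> sn; rewrite /t /c [\prod_(s <= i < _) _]big_ltn ?ltnS //.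
  rewrite [in LHS]big_nat_recr ?ltnS //= big_ord_recr /=.
  rewrite (_ : s * n.+1.*2.+1 = s.*2 + s * n.*2.+1)%N; last by lia.
  rewrite (_ : s.+1 * n.*2.+1 = n.*2.+1 + s * n.*2.+1)%N; last by lia.
  by rewrite doubleS !exprD ![q ^+ _.+1]exprS; ring.
rewrite big_ord_recr /= (eq_bigr (fun s : 'I__ =>
  (1 - q ^+ n.*2.+1) * t n s + (c n s.+1 - c n s))); last first.
  by move=> s _; apply: step; rewrite ltnW.
rewrite big_split -mulr_sumr IHn /=.
rewrite -(big_mkord xpredT (fun s => c n s.+1 - c n s)) telescope_sumr //.
rewrite doubleS [X in _ = _ * X]big_ord_recr [X in _ = _ * (X + _)]big_ord_recr.
rewrite [X in _ = X * _]big_ord_recr /=.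
rewrite {2}/c [\prod_(0 <= i < _) _]big_ltn //
  expr0 subrr !(mul0r, mulr0) subr0.
rewrite /c /t !big_nat1.
have -> : tri n.*2 = (n * n.*2.+1)%N by have := triE n.*2; nia.
have -> : tri n.*2.+1 = (n.*2.+1 + n * n.*2.+1)%N by have := triE n.*2.+1; nia.
rewrite (_ : n * n.+1.*2.+1 = n.*2 + n * n.*2.+1)%N; last by lia.
by rewrite doubleS !exprD ![q ^+ _.+1]exprS; ring.
Qed.

Lemma psi_prod : odd_prod * psi = subX 2 euler_prod.
Proof.
apply: eq_belowP => N.
apply: (@eq_below_trans _ _ _
   (\prod_(i < N.+1) (1 - q ^+ i.*2.+1) * \sum_(s < N.+1.*2) q ^+ tri s)).
  apply: eq_belowM; first by apply: iprod_below => //; apply: multipliable_odd.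
  by apply: isum_below; [exact: summable_psi | lia].
rewrite -psi_finite big_ord_recl mul0n !expr0 !mul1r big_ord0 mulr1.
rewrite -[subX 2 _]addr0; apply: (@eq_belowD _ N).
  rewrite big_add1 big_mkord; apply: eq_below_sym.
  rewrite subX_iprod //; last exact: multipliable_euler.
  under eq_bigr => i _ do rewrite -mul2n -subXqX // -[1](@subX1 _ 2) //
    -subXN -subXD.
  apply: iprod_below; last by [].
  by apply: multipliable_subX => //; apply: multipliable_euler.
move=> n nN; rewrite fps_sum big1 // => s _.
by apply: eq_below_qXM nN; rewrite /= /bump; nia.
Qed.

(** * Relations between theta series *)

Lemma subN_theta : subN theta = odd_prod * euler_prod.
Proof. by rewrite -theta_prod mulrA odd_distinct mul1r. Qed.

Lemma subN_thetaE : subN theta = odd_prod ^+ 2 * subX 2 euler_prod.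
Proof. by rewrite subN_theta -{1}odd_euler mulrA. Qed.

Lemma odd_prod_subN : odd_prod * subN odd_prod = subX 2 odd_prod.
Proof.
rewrite /odd_prod subN_iprod ?subX_iprod //; try exact: multipliable_odd.
rewrite iprodM; first last.
- by apply: multipliable_subN; apply: multipliable_odd.
- exact: multipliable_odd.
apply: eq_iprod => i; rewrite subN_D subXD subN_N subXN subN_1 subX1 //.
rewrite subXqX // subN_qX mulnC exprM -[(-1) ^+ _]signr_odd /= odd_double.
by ring.
Qed.

(** Both sides equal the square of [odd_prod (q ^ 2) * euler_prod (q ^ 2)]. *)
Lemma theta_subN : theta * subN theta = subX 2 (subN theta) ^+ 2.
Proof.
rewrite [in RHS]subN_theta subXM // -odd_prod_subN -[X in X * _]subN_K.
by rewrite subN_thetaE !subN_M subN_subX2; ring.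
Qed.

(** The even squares are [4 * k ^ 2] and the odd ones are [8 * tri k + 1]. *)
Lemma theta_split : theta = subX 4 theta + 2%:R * q * subX 8 psi.
Proof.
apply: eq_belowP => N.
apply: (@eq_below_trans _ _ _ (\sum_(k < N.*2) theta_term k)).
  by apply: isum_below; [apply: summable_theta | lia].
apply: eq_below_sym; apply: (@eq_below_trans _ _ _
  (subX 4 (\sum_(k < N) theta_term k) +
   2%:R * q * subX 8 (\sum_(k < N) q ^+ tri k))).
  apply: eq_belowD; last apply: eq_belowM => //; apply: subX_below => //.
    by apply: isum_below => //; apply: summable_theta.
  by apply: isum_below => //; apply: summable_psi.
rewrite (_ : _ + _ = \sum_(k < N.*2) theta_term k) //.
elim: N => [|N IHN]; first by rewrite !big_ord0 !subX0 mulr0 addr0.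
rewrite doubleS !big_ord_recr /= -IHN !subXD /theta_term subXM // subXnat //.
rewrite !subXqX // (_ : N.*2 ^ 2 = 4 * N ^ 2)%N; last by nia.
rewrite (_ : N.*2.+1 ^ 2 = (8 * tri N).+1)%N; last by have := triE N; nia.
by rewrite double_gt0 ltn0Sn [q ^+ _.+1]exprS -[nat_of_bool true]/1%N; ring.
Qed.

End Gauss.

(** * A quadratic form in two variables *)

Definition int_range (N : nat) : seq int :=
  [seq Posz i | i <- iota 0 N] ++ [seq Negz i | i <- iota 0 N].

Lemma mem_int_range N (x : int) : (x \in int_range N) = (- N%:Z <= x < N%:Z).
Proof.
rewrite mem_cat; case: x => k.
  rewrite mem_map; last by move=> ? ? [].
  rewrite mem_iota /= add0n (_ : (Posz k \in _) = false) ?orbF;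
    last by apply/mapP => -[].
  by lia.
rewrite mem_map ?mem_iota; last by move=> ? ? [].
rewrite (_ : (Negz k \in _) = false); last by apply/mapP => -[].
by rewrite /= NegzE; lia.
Qed.

Lemma uniq_int_range N : uniq (int_range N).
Proof.
rewrite cat_uniq !map_inj_uniq ?iota_uniq ?andbT /=; try by move=> ? ? [].
by apply/hasPn => x /mapP[k _ ->]; apply/mapP => -[].
Qed.

Section Quadratic.
Variable R : comNzRingType.
Local Notation q := (q R).

(** The triangular numbers are the values [a * (2 * a + 1)], [a] running over all
    integers: this makes [psi] a sum over [int], like [theta]. *)
Definition int_sq (a : int) := (absz a ^ 2)%N.
Definition int_tri (a : int) := absz (a * (2 * a + 1)).

Lemma int_sqE a : (int_sq a)%:Z = a * a.
Proof. by rewrite /int_sq; nia. Qed.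

Lemma int_triE a : (int_tri a)%:Z = 2 * a * a + a.
Proof. by rewrite /int_tri; nia. Qed.

Lemma sum_int_range N (F : int -> fps R) :
  \sum_(a <- int_range N) F a = \sum_(k < N) (F (Posz k) + F (Negz k)).
Proof.
rewrite -(big_mkord xpredT (fun k => F (Posz k) + F (Negz k))) big_split.
by rewrite big_cat !big_map /index_iota subn0.
Qed.

Lemma sum_int_range_double N (F : int -> fps R) :
  \sum_(a <- int_range N.*2) F a =
  \sum_(a <- int_range N) (F (2 * a) + F (2 * a + 1)).
Proof.
rewrite !sum_int_range; elim: N => [|N IHN]; first by rewrite !big_ord0.
rewrite doubleS !big_ord_recr /= {}IHN.
have -> : 2 * Posz N = Posz N.*2 by lia.
have -> : 2 * Negz N = Negz N.*2.+1 by lia.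
have -> : Posz N.*2 + 1 = Posz N.*2.+1 by lia.
have -> : Negz N.*2.+1 + 1 = Negz N.*2 by lia.
by ring.
Qed.

Lemma psi_below N M : (N <= M)%N ->
  eq_below N (psi R) (\sum_(a <- int_range M) q ^+ int_tri a).
Proof.
move=> NM; have NM2 : (N <= M.*2)%N by lia.
apply: eq_below_trans (isum_below (@summable_psi R) NM2) _.
rewrite sum_int_range (_ : \sum_(k < M.*2) _ =
  \sum_(k < M) (q ^+ int_tri (Posz k) + q ^+ int_tri (Negz k))) //.
elim: M {NM NM2} => [|M IHM]; first by rewrite !big_ord0.
rewrite doubleS !big_ord_recr /= IHM -addrA.
by congr (_ + (q ^+ _ + q ^+ _)); have := triE M.*2; have := triE M.*2.+1;
  have := int_triE M; have := int_triE (Negz M); nia.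
Qed.

Lemma theta_below N M : (N <= M)%N ->
  eq_below N (theta R) (\sum_(a <- int_range M) q ^+ int_sq a).
Proof.
move=> NM; apply: eq_below_trans (isum_below (@summable_theta R) NM) _.
case: M NM => [|M NM]; first by case: N.
rewrite sum_int_range (_ : \sum_(k < M.+1) (_ + _) =
    \sum_(k < M.+1) @theta_term R k + q ^+ (M.+1 ^ 2)).
  rewrite -[X in eq_below _ X]addr0; apply: eq_belowD => //.
  by apply/eq_below_sym/eq_below_qX; nia.
elim: M {NM} => [|M IHM]; first by rewrite !big_ord1 /theta_term mul1r.
rewrite big_ord_recr IHM [in RHS]big_ord_recr /=.
rewrite (_ : int_sq (Posz M.+1) = (M.+1 ^ 2)%N) //.
rewrite (_ : int_sq (Negz M.+1) = (M.+2 ^ 2)%N) //.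
by rewrite -[theta_term R M.+1]/(2%:R * q ^+ (M.+1 ^ 2)%N); ring.
Qed.

(** Below degree [N], a sum over a large box only depends on the terms of small
    exponent, hence can be reindexed by a map which is a bijection on those. *)
Lemma reindex_below N (T1 T2 : eqType) (l1 : seq T1) (l2 : seq T2)
    (e1 : T1 -> nat) (e2 : T2 -> nat) (P : pred T2) (s : T1 -> T2) :
  uniq l1 -> uniq l2 -> injective s -> (forall x, e2 (s x) = e1 x) ->
  (forall x, (e1 x < N)%N -> x \in l1) ->
  (forall y, (e2 y < N)%N -> y \in l2) ->
  (forall x, P (s x)) -> (forall y, P y -> exists x, y = s x) ->
  eq_below N (\sum_(x <- l1) q ^+ e1 x) (\sum_(y <- l2 | P y) q ^+ e2 y).
Proof.
move=> u1 u2 injs es m1 m2 Ps sP.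
have cut (T : eqType) (l : seq T) (e : T -> nat) (Q : pred T) :
    eq_below N (\sum_(x <- l | Q x) q ^+ e x)
               (\sum_(x <- [seq x <- l | Q x && (e x < N)%N]) q ^+ e x).
  move=> n nN; rewrite !fps_sum big_filter big_mkcondr; apply: eq_bigr => x _.
  by case: ifP => // xN; rewrite qX (_ : (n == e x) = false) //; lia.
apply: eq_below_trans (cut _ _ _ _) _.
apply: eq_below_sym; apply: eq_below_trans (cut _ _ _ _) _.
rewrite -(eq_bigr _ (fun x _ => congr1 (fun k => q ^+ k) (es x))).
rewrite -(big_map s xpredT (fun y => q ^+ e2 y)); apply: eq_below_sym.
rewrite (perm_big [seq y <- l2 | P y && (e2 y < N)%N]) //.
apply: uniq_perm; rewrite ?filter_uniq ?map_inj_uniq ?filter_uniq //.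
move=> y; rewrite mem_filter; apply/mapP/idP => [[x]|].
  rewrite mem_filter => /andP[xN xl1] ->.
  by rewrite Ps es xN m2 // es.
case/andP=> /andP[Py yN] yl2; have [x yx] := sP y Py.
have xN : (e1 x < N)%N by rewrite -es -yx.
by exists x => //; rewrite mem_filter xN m1.
Qed.

Definition quad_exp (y : int * int) := (int_tri y.1 + 3 * int_tri y.2)%N.
Definition quad_class (y : int * int) : int := ((y.1 - y.2) %% 4)%Z.

Lemma big_quad_class (l : seq (int * int)) (F : int * int -> fps R) :
  \sum_(y <- l) F y =
  \sum_(y <- l | quad_class y == 0) F y +
    \sum_(y <- l | quad_class y == 2) F y +
  (\sum_(y <- l | quad_class y == 3) F y +
    \sum_(y <- l | quad_class y == 1) F y).
Proof.
have cond r : \sum_(y <- l | quad_class y == r) F y =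
    \sum_(y <- l) if quad_class y == r then F y else 0 by rewrite big_mkcond.
rewrite !cond -!big_split /=.
apply: eq_bigr => y _.
have: [|| quad_class y == 0, quad_class y == 1,
  quad_class y == 2 | quad_class y == 3].
  by rewrite /quad_class; lia.
by case/or4P=> /eqP -> /=; rewrite ?addr0 ?add0r.
Qed.

Definition box N := [seq (a, b) | a <- int_range N, b <- int_range N].

Lemma mem_box N x y :
  x \in int_range N -> y \in int_range N -> (x, y) \in box N.
Proof. exact: allpairs_f. Qed.

Lemma uniq_box N : uniq (box N).
Proof. by apply: allpairs_uniq; rewrite ?uniq_int_range // => -[? ?] []. Qed.

Lemma sum_box N (F G : int -> fps R) :
  (\sum_(a <- int_range N) F a) * (\sum_(b <- int_range N) G b) =
  \sum_(y <- box N) F y.1 * G y.2.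
Proof.
rewrite big_allpairs mulr_suml; apply: eq_bigr => a _.
by rewrite mulr_sumr.
Qed.

Lemma int_sq_range N a : (int_sq a < N)%N -> a \in int_range N.
Proof. by rewrite mem_int_range => aN; have := int_sqE a; nia. Qed.

Lemma int_tri_range N a : (int_tri a < N)%N -> a \in int_range N.
Proof. by rewrite mem_int_range => aN; have := int_triE a; nia. Qed.

Lemma quad_exp_box N y : (quad_exp y < N)%N -> y \in box N.
Proof.
case: y => a b; rewrite /quad_exp /= => yN.
by apply: mem_box; apply: int_tri_range; lia.
Qed.

Lemma quad_class_below N r (e : int * int -> nat) (s : int * int -> int * int) :
  injective s -> (forall x, quad_exp (s x) = e x) ->
  (forall x, (e x < N)%N -> x \in box N) ->
  (forall x, quad_class (s x) = r) ->
  (forall y, quad_class y = r -> exists x, y = s x) ->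
  eq_below N (\sum_(x <- box N) q ^+ e x)
             (\sum_(y <- box N | quad_class y == r) q ^+ quad_exp y).
Proof.
move=> injs es eN sr rs; apply: (reindex_below (s := s)) => //.
- exact: uniq_box.
- exact: uniq_box.
- exact: quad_exp_box.
- by move=> x; rewrite sr.
- by move=> y /eqP; apply: rs.
Qed.

(** Under [u = a + 3 * b + 1] and [v = a - b], twice the exponent
    [a * (2 * a + 1) + 3 * b * (2 * b + 1)] is [u ^ 2 + 3 * v ^ 2 - 1], where
    [u - v] is 1 modulo 4. The class of [v] modulo 4 is then free, and decides
    which of [u] and [v] is even. *)
Lemma psi_psi3 :
  psi R * subX 3 (psi R) =
  subX 4 (psi R) * subX 6 (theta R) + q * subX 2 (theta R) * subX 12 (psi R).
Proof.
have theta_sum k N (sN : (0 < k)%N) : eq_below N (subX k (theta R))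
    (\sum_(j <- int_range N) q ^+ (k * int_sq (2 * j)) +
     \sum_(j <- int_range N) q ^+ (k * int_sq (2 * j + 1))).
  have NN2 : (N <= N.*2)%N by lia.
  rewrite -big_split -(sum_int_range_double N (fun a => q ^+ (k * int_sq a))).
  under eq_bigr => a _ do rewrite -subXqX //.
  by rewrite -subX_sum; apply/subX_below/theta_below.
have psi_sum k N (sN : (0 < k)%N) : eq_below N (subX k (psi R))
    (\sum_(j <- int_range N) q ^+ (k * int_tri j)).
  under eq_bigr => a _ do rewrite -subXqX //.
  by rewrite -subX_sum; apply/subX_below/psi_below.
apply: eq_belowP => N.
apply: (@eq_below_trans _ _ _ (\sum_(y <- box N) q ^+ quad_exp y)).
  apply: eq_below_trans (eq_belowM (psi_below (leqnn N)) (psi_sum 3 N isT)) _.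
  rewrite sum_box /quad_exp; under eq_bigr => y _ do rewrite -exprD.
  exact: eq_below_refl.
(* The classes 0 and 2 make up the first product, the classes 3 and 1 the second.
   The index of the sum for [theta] is [2 * j] or [2 * j + 1], that of the sum
   for [psi] is [t]. *)
rewrite big_quad_class; apply: eq_below_sym; apply: eq_belowD.
  rewrite mulrC; apply: eq_below_trans (eq_belowM (theta_sum 6 N isT)
    (psi_sum 4 N isT)) _.
  rewrite mulrDl !sum_box; apply: eq_belowD.
    under eq_bigr => y _ do rewrite -exprD.
    apply: (quad_class_below (s := fun x => (x.2 + 3 * x.1, x.2 - x.1))).
    - by move=> [j t] [j' t'] [h1 h2]; congr pair; lia.
    - case=> j t /=; rewrite /quad_exp /=.
      have := int_triE (t + 3 * j); have := int_triE (t - j).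
      by have := int_sqE (2 * j); have := int_triE t; nia.
    - case=> j t /= jN; apply: mem_box; last by apply: int_tri_range; lia.
      by apply: int_sq_range; move: jN; have := int_sqE (2 * j);
        have := int_sqE j; nia.
    - by case=> j t; rewrite /quad_class /=; lia.
    case=> a b; rewrite /quad_class /= => ab.
    by exists (((a - b) %/ 4)%Z, b + ((a - b) %/ 4)%Z); congr pair; rewrite /=;
      lia.
  under eq_bigr => y _ do rewrite -exprD.
  apply: (quad_class_below (s := fun x =>
    (- x.2 + 3 * x.1 + 1, - x.2 - x.1 - 1))).
  - by move=> [j t] [j' t'] [h1 h2]; congr pair; lia.
  - case=> j t /=; rewrite /quad_exp /=.
    have := int_triE (- t + 3 * j + 1); have := int_triE (- t - j - 1).
    by have := int_sqE (2 * j + 1); have := int_triE t; nia.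
  - case=> j t /= jN; apply: mem_box; last by apply: int_tri_range; lia.
    by apply: int_sq_range; move: jN; have := int_sqE (2 * j + 1);
      have := int_sqE j; nia.
  - by case=> j t; rewrite /quad_class /=; lia.
  case=> a b; rewrite /quad_class /= => ab.
  by exists (((a - b) %/ 4)%Z, - b - ((a - b) %/ 4)%Z - 1); congr pair;
    rewrite /=; lia.
rewrite -mulrA; apply: eq_below_trans
  (eq_belowM (eq_below_refl _) (eq_belowM (theta_sum 2 N isT)
    (psi_sum 12 N isT))) _.
rewrite mulrDl mulrDr !sum_box !mulr_sumr; apply: eq_belowD.
  under eq_bigr => y _ do rewrite -exprD -exprS.
  apply: (quad_class_below (s := fun x => (x.1 - 3 * x.2 - 1, x.1 + x.2))).
  - by move=> [j t] [j' t'] [h1 h2]; congr pair; lia.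
  - case=> j t /=; rewrite /quad_exp /=.
    have := int_triE (j - 3 * t - 1); have := int_triE (j + t).
    by have := int_sqE (2 * j); have := int_triE t; nia.
  - case=> j t /= jN; apply: mem_box; last by apply: int_tri_range; lia.
    by apply: int_sq_range; move: jN; have := int_sqE (2 * j);
      have := int_sqE j; nia.
  - by case=> j t; rewrite /quad_class /=; lia.
  case=> a b; rewrite /quad_class /= => ab.
  by exists (b + ((a - b) %/ 4)%Z + 1, - ((a - b) %/ 4)%Z - 1); congr pair;
    rewrite /=; lia.
under eq_bigr => y _ do rewrite -exprD -exprS.
apply: (quad_class_below (s := fun x => (x.1 + 3 * x.2 + 1, x.1 - x.2))).
- by move=> [j t] [j' t'] [h1 h2]; congr pair; lia.
- case=> j t /=; rewrite /quad_exp /=.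
  have := int_triE (j + 3 * t + 1); have := int_triE (j - t).
  by have := int_sqE (2 * j + 1); have := int_triE t; nia.
- case=> j t /= jN; apply: mem_box; last by apply: int_tri_range; lia.
  by apply: int_sq_range; move: jN; have := int_sqE (2 * j + 1);
    have := int_sqE j; nia.
- by case=> j t; rewrite /quad_class /=; lia.
case=> a b; rewrite /quad_class /= => ab.
by exists (b + ((a - b) %/ 4)%Z, ((a - b) %/ 4)%Z); congr pair; rewrite /=; lia.
Qed.

End Quadratic.

(** * Inverses and congruences *)

Section Congruence.
Variable R : comNzRingType.
Implicit Types x y z u : fps R.

(** The geometric series in [1 - u]. *)
Lemma fps_inv u : u 0%N = 1 -> exists v, u * v = 1.
Proof.
move=> u0; pose x := 1 - u; pose v := isum (fun i => x ^+ i).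
have xi i : eq_below i (x ^+ i) 0.
  elim: i => [|i IHi] // n ni; rewrite exprS fpsM big_ord_recl.
  rewrite (_ : x 0%N = 0); last by rewrite fpsB u0 subrr.
  rewrite mul0r add0r big1 // => j _; have jn := ltn_ord j.
  by rewrite IHi ?mulr0 //= /bump; lia.
exists v; apply: eq_belowP => N.
apply: (@eq_below_trans _ _ _ (u * \sum_(i < N) x ^+ i)).
  by apply: eq_belowM => //; apply: isum_below.
rewrite (_ : u = - (x - 1)); last by rewrite /x; ring.
rewrite mulNr -subrX1 opprB -[X in eq_below _ _ X]subr0.
by move=> n nN; rewrite !fpsB xi.
Qed.

Definition eqm m x y := exists z, x = y + m%:R * z.

Lemma eqm_refl m x : eqm m x x. Proof. by exists 0; ring. Qed.

Lemma eqm_sym m x y : eqm m x y -> eqm m y x.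
Proof. by case=> z ->; exists (- z); ring. Qed.

Lemma eqm_trans m x y z : eqm m x y -> eqm m y z -> eqm m x z.
Proof. by move=> [a ->] [b ->]; exists (a + b); ring. Qed.

Lemma eqmD m x x' y y' : eqm m x x' -> eqm m y y' -> eqm m (x + y) (x' + y').
Proof. by move=> [a ->] [b ->]; exists (a + b); ring. Qed.

Lemma eqmM m x x' y y' : eqm m x x' -> eqm m y y' -> eqm m (x * y) (x' * y').
Proof.
by move=> [a ->] [b ->]; exists (a * y' + x' * b + m%:R * a * b); ring.
Qed.

Lemma eqmX m x y n : eqm m x y -> eqm m (x ^+ n) (y ^+ n).
Proof.
move=> xy; elim: n => [|n IHn]; first exact: eqm_refl.
by rewrite !exprS; apply: eqmM.
Qed.

Lemma eqm_even m x y : eqm m x y -> eqm m (even_part x) (even_part y).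
Proof.
by case=> z ->; exists (even_part z); rewrite even_partD even_partMnat.
Qed.

Lemma eqm_odd m x y : eqm m x y -> eqm m (odd_part x) (odd_part y).
Proof.
by case=> z ->; exists (odd_part z); rewrite odd_partD odd_partMnat.
Qed.

Lemma eqm_subX m k x y : (0 < k)%N -> eqm m x y -> eqm m (subX k x) (subX k y).
Proof.
by move=> k0 [z ->]; exists (subX k z); rewrite subXD subXM // subXnat.
Qed.

Lemma eqm_mulr m k x y : eqm m x y -> eqm (k * m) (k%:R * x) (k%:R * y).
Proof. by case=> z ->; exists z; rewrite natrM; ring. Qed.

Lemma eqm_weaken k m x y : eqm (k * m) x y -> eqm m x y.
Proof. by case=> z ->; exists (k%:R * z); rewrite natrM; ring. Qed.

(** With [x = y + m * z], the cross term [2 * m * y * z] and, [m] being even, the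
    term [m ^ 2 * z ^ 2] are divisible by [2 * m]. *)
Lemma eqm_sqr m x y : ~~ odd m -> eqm m x y -> eqm (2 * m) (x ^+ 2) (y ^+ 2).
Proof.
rewrite -dvdn2 => /dvdnP[k ->] [z ->]; exists (y * z + k%:R * z ^+ 2).
by rewrite !natrM; ring.
Qed.

Lemma eqm_cancel m u x y : u 0%N = 1 -> eqm m (u * x) (u * y) -> eqm m x y.
Proof.
move=> /fps_inv[v uv] [z xy]; exists (v * z).
have vu w : v * (u * w) = w by rewrite mulrA [v * u]mulrC uv mul1r.
by rewrite -[x]vu xy mulrDr vu; ring.
Qed.

Lemma eqm0 m x : eqm m (m%:R * x) 0.
Proof. by exists x; rewrite add0r. Qed.
End Congruence.

Lemma eqmP m (x y : fps int) : (forall n, m%:Z %| x n - y n)%Z -> eqm m x y.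
Proof.
move=> xy; exists (Fps (fun n => ((x n - y n) %/ m)%Z)).
apply: fpsP => n; rewrite fpsD fpsMnat /= natz mulrC divzK; last exact: xy.
by rewrite addrC subrK.
Qed.

(** Induction on the coefficient: with [a] and [b] the even and odd parts of [x],
    [x ^ 2] is [(a ^ 2 + q * b ^ 2) (q ^ 2)] modulo 2, and the coefficients of
    [a ^ 2] and [b ^ 2] involved have a smaller index, except at index 0. *)
Lemma frobenius2 (x : fps int) : eqm 2 (x ^+ 2) (subX 2 x).
Proof.
apply: eqmP => n; elim/ltn_ind: n x => n IHn x.
have sqr_parts : x ^+ 2 = subX 2 (even_part x ^+ 2 + q int * odd_part x ^+ 2) +
    q int * subX 2 (2%:R * (even_part x * odd_part x)).
  by rewrite {1}[x]parts_eq !(subXD, subXX, subXM, subXq, subXnat) //; ring.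
case on: (odd n).
  have nE : n = n./2.*2.+1 by lia.
  rewrite nE -!(odd_part_coef _ n./2) sqr_parts odd_partK odd_part_subX subr0.
  by rewrite fpsMnat natz dvdz_mulr.
case: (posnP n) => [-> | n_gt0].
  rewrite subX_coef0 expr2 fpsM0 -[X in _ - X]mulr1 -mulrBr.
  have [x0|x0] := boolP (2 %| x 0%N)%Z; first exact: dvdz_mulr.
  apply: dvdz_mull; move: x0; rewrite !dvdzE; move: (x 0%N) => c.
  by lia.
have nE : n = n./2.*2 by lia.
have lt_n : (n./2 < n)%N by lia.
rewrite nE -!(even_part_coef _ n./2) sqr_parts even_partK even_part_subX.
have /dvdzP[a aE] := IHn _ lt_n (even_part x).
have -> : x n./2 = subX 2 (even_part x) n./2 +
  (q int * subX 2 (odd_part x)) n./2.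
  by rewrite -fpsD -parts_eq.
rewrite fpsD !qM; case nE2: n./2 => [|k]; first lia.
have lt_k : (k < n)%N by lia.
have /dvdzP[b bE] := IHn _ lt_k (odd_part x).
apply/dvdzP; exists (a + b); rewrite mulrDl -aE -bE nE2.
by ring.
Qed.

(** * Following the even parts modulo 8 *)

Section Rewriting.
Variable R : comNzRingType.

#[export] Instance eqm_equivalence m : Equivalence (@eqm R m).
Proof. by split; [exact: eqm_refl | exact: eqm_sym | exact: eqm_trans]. Qed.

#[export] Instance eqmD_proper m : Proper (eqm m ==> eqm m ==> eqm m)
  (@GRing.add (fps R)).
Proof. by move=> x x' xx y y' yy; apply: eqmD. Qed.

#[export] Instance eqmM_proper m : Proper (eqm m ==> eqm m ==> eqm m)
  (@GRing.mul (fps R)).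
Proof. by move=> x x' xx y y' yy; apply: eqmM. Qed.

#[export] Instance eqmX_proper m : Proper (eqm m ==> eq ==> eqm m) (@GRing.exp
  (fps R)).
Proof. by move=> x x' xx n _ <-; apply: eqmX. Qed.

#[export] Instance eqm_even_proper m : Proper (eqm m ==> eqm m) (@even_part R).
Proof. by move=> x x' xx; apply: eqm_even. Qed.

#[export] Instance eqm_odd_proper m : Proper (eqm m ==> eqm m) (@odd_part R).
Proof. by move=> x x' xx; apply: eqm_odd. Qed.

#[export] Instance eqm_subX2_proper m : Proper (eqm m ==> eqm m) (@subX R 2).
Proof. by move=> x x' xx; apply: eqm_subX. Qed.

Lemma even_part_sqr (x : fps R) :
  even_part (x ^+ 2) = even_part x ^+ 2 + q R * odd_part x ^+ 2.
Proof.
apply: (@even_partE _ _ _ (2%:R * (even_part x * odd_part x))).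
by rewrite {1}[x]parts_eq !(subXD, subXX, subXM, subXq, subXnat) //; ring.
Qed.

Lemma odd_part_sqr (x : fps R) :
  odd_part (x ^+ 2) = 2%:R * (even_part x * odd_part x).
Proof.
apply: (@odd_partE _ _ (even_part x ^+ 2 + q R * odd_part x ^+ 2)).
by rewrite {1}[x]parts_eq !(subXD, subXX, subXM, subXq, subXnat) //; ring.
Qed.

End Rewriting.

#[local] Hint Resolve eqm_refl : core.

(** The properties of the generating series on which the congruences depend; [h]
    stands for the product over [m] of [1 + q ^ (3 * m)]. *)
Section Descent.
Variables (G B C h D W : fps int).
Local Notation q := (q int).
Hypothesis evenG : even_part G = G ^+ 2.
Hypothesis oddG : odd_part G = B.
Hypothesis evenB : even_part B = C.
Hypothesis C_h2 : eqm 4 C (h ^+ 2).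
Hypothesis oddB : odd_part B = 4%:R * D.
Hypothesis evenD : eqm 2 D (subX 2 W).
Hypothesis odd_h4 : eqm 8 (odd_part (odd_part (h ^+ 4))) (4%:R * h ^+ 7).

Let lift4 (x y : fps int) : eqm 2 x y -> eqm 8 (4%:R * x) (4%:R * y).
Proof. exact: (@eqm_mulr _ 2 4). Qed.

Let lift2 (x y : fps int) : eqm 4 x y -> eqm 8 (2%:R * x) (2%:R * y).
Proof. exact: (@eqm_mulr _ 4 2). Qed.

Let sqr8 (x y : fps int) : eqm 4 x y -> eqm 8 (x ^+ 2) (y ^+ 2).
Proof. exact: (@eqm_sqr _ 4). Qed.

Let sqr4 (x y : fps int) : eqm 2 x y -> eqm 4 (x ^+ 2) (y ^+ 2).
Proof. exact: (@eqm_sqr _ 2). Qed.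

Let mod2 (x y : fps int) : eqm 4 x y -> eqm 2 x y.
Proof. exact: (@eqm_weaken _ 2 2). Qed.

Let kill8 (x : fps int) : eqm 8 (8%:R * x) 0. Proof. exact: eqm0. Qed.

Let B_subX : eqm 4 B (subX 2 C).
Proof.
exists (q * subX 2 D); rewrite {1}[B]parts_eq evenB oddB subXM // subXnat //.
by rewrite mulrCA.
Qed.

Let B_sqr : eqm 8 (B ^+ 2) (subX 2 (C ^+ 2)).
Proof. by rewrite subXX //; apply: sqr8. Qed.

Let C_sqr : eqm 8 (C ^+ 2) (h ^+ 4).
Proof. by rewrite (exprM h 2 2); apply: sqr8. Qed.

(** Both sides are [h (q ^ 2) ^ 2] modulo 4. *)
Let B_h4 : eqm 4 B (h ^+ 4).
Proof.
rewrite B_subX C_h2 (exprM h 2 2) subXX //; apply/eqm_sym/sqr4.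
exact: frobenius2.
Qed.

Lemma descent0 : eqm 8 (odd_part (odd_part (odd_part G))) 0.
Proof. by rewrite oddG oddB odd_partMnat (lift4
  (eqm_odd evenD)) odd_part_subX mulr0. Qed.

Let G_sqr : eqm 2 (G ^+ 2) (subX 2 G). Proof. exact: frobenius2. Qed.

Let h_sqr : eqm 2 (h ^+ 2) (subX 2 h). Proof. exact: frobenius2. Qed.

Let B_mod2 : eqm 2 B (subX 2 C). Proof. exact: mod2 B_subX. Qed.

Let C_mod2 : eqm 2 C (subX 2 h).
Proof. exact: eqm_trans (mod2 C_h2) h_sqr. Qed.

(** The odd part of [G ^ 2] is [2 * G ^ 2 * B], whose own odd part is 4 times a
    product of three series that are all even modulo 2. *)
Lemma descent1 :
  eqm 8 (odd_part (odd_part (odd_part (even_part G)))) 0.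
Proof.
rewrite evenG odd_part_sqr evenG oddG odd_partMnat.
have -> : eqm 8 (2%:R * odd_part (G ^+ 2 * B)) (4%:R * subX 2 (C * G * h)).
  rewrite (_ : 4 = 2 * 2)%N // natrM -mulrA; apply: lift2.
  have -> : eqm 4 (G ^+ 2 * B) (subX 2 C * G ^+ 2) by rewrite B_subX mulrC.
  rewrite odd_part_subXM odd_part_sqr evenG oddG.
  rewrite (_ : C * _ = 2%:R * (C * G ^+ 2 * B)); last by ring.
  apply: (@eqm_mulr _ 2 2); 
  rewrite (_ : C * G * h = h * G * C) ?subXM //; last by ring.
  exact: eqmM (eqmM C_mod2 G_sqr) B_mod2.
by rewrite odd_partMnat odd_part_subX mulr0.
Qed.

Let F2 := G ^+ 4 + q * B ^+ 2.
Let F3 := G ^+ 8 + 6%:R * (q * (G ^+ 4 * B ^+ 2)) + q * (q * B ^+ 4).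

Let even2 : even_part (even_part G) = F2.
Proof. by rewrite evenG even_part_sqr evenG oddG /F2; ring. Qed.

Let F2_mod2 : eqm 2 F2 G.
Proof. by rewrite -even2 evenG G_sqr even_part_subX. Qed.

Let even_G4 : even_part (G ^+ 4) = F2 ^+ 2 + 4%:R * q * G ^+ 4 * B ^+ 2.
Proof.
rewrite (exprM G 2 2) even_part_sqr odd_part_sqr even_part_sqr evenG oddG /F2.
by ring.
Qed.

Let odd_G4 : odd_part (G ^+ 4) = 4%:R * (F2 * G ^+ 2 * B).
Proof.
rewrite (exprM G 2 2) !odd_part_sqr even_part_sqr evenG oddG /F2.
by ring.
Qed.

Let odd_G8 : eqm 8 (odd_part (G ^+ 8)) 0.
Proof.
rewrite (exprM G 4 2) odd_part_sqr odd_G4.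
rewrite (_ : 2%:R * _ = 8%:R * (even_part (G ^+ 4) * (F2 * G ^+ 2 * B))).
  exact: kill8.
by ring.
Qed.

Let even_G8 : eqm 8 (even_part (G ^+ 8)) (G ^+ 4).
Proof.
rewrite (exprM G 4 2) even_part_sqr odd_G4 even_G4.
have -> : (F2 ^+ 2 + 4%:R * q * G ^+ 4 * B ^+ 2) ^+ 2 +
    q * (4%:R * (F2 * G ^+ 2 * B)) ^+ 2 = F2 ^+ 4 +
    8%:R * (F2 ^+ 2 * (q * G ^+ 4 * B ^+ 2) + 2%:R * (q * G ^+ 4 * B ^+ 2) ^+ 2
            + 2%:R * q * (F2 * G ^+ 2 * B) ^+ 2) by ring.
rewrite kill8 addr0 !(exprM _ 2 2); apply/sqr8/sqr4.
exact: F2_mod2.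
Qed.

Let even_B2 : eqm 8 (even_part (B ^+ 2)) (h ^+ 4).
Proof. by rewrite B_sqr even_part_subX C_sqr. Qed.

Let odd_B2 : eqm 8 (odd_part (B ^+ 2)) 0.
Proof. by rewrite B_sqr odd_part_subX. Qed.

(** The odd parts of the two terms of [F2] are [4 * G ^ 3 * B] and [h ^ 4]
    modulo 8. Taking the odd part twice more turns each of them into
    [4 * h ^ 7], and the sum of both vanishes. *)
Lemma descent2 : eqm 8 (odd_part (odd_part (odd_part F2))) 0.
Proof.
have -> : eqm 8 (odd_part F2) (4%:R * (subX 2 (G * C) * G) + h ^+ 4).
  rewrite odd_partD odd_part_qM even_B2 odd_G4; apply: eqmD => //.
  apply: lift4; rewrite F2_mod2 G_sqr B_mod2 subXM //.
  by rewrite (_ : _ * _ * _ = subX 2 G * subX 2 C * G) //; ring.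
rewrite !odd_partD !odd_partMnat odd_h4 odd_part_subXM oddG.
have -> : eqm 8 (4%:R * odd_part (G * C * B)) (4%:R * h ^+ 7).
  apply: lift4; have -> : eqm 2 (G * C * B) (subX 2 (h * C) * G).
    rewrite {1}C_mod2 B_mod2 subXM //.
    by rewrite (_ : _ * _ * _ = subX 2 h * subX 2 C * G) //; ring.
  rewrite odd_part_subXM oddG (mod2 C_h2) (mod2 B_h4).
  by rewrite (_ : _ * _ * _ = h ^+ 7) //; ring.
by rewrite (_ : _ + _ = 8%:R * h ^+ 7); [exact: kill8 | ring].
Qed.

Let F3E : even_part (G ^+ 4) = F3.
Proof. by rewrite even_G4 /F2 /F3; ring. Qed.

Let even3 : eqm 8 (even_part F2) F3.
Proof.
by rewrite even_partD even_part_qM odd_B2 mulr0 addr0 F3E.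
Qed.

Let B4 : eqm 8 (B ^+ 4) (subX 2 (C ^+ 4)).
Proof. by rewrite !(exprM _ 2 2) B_sqr !subXX. Qed.

Let middle : eqm 8 (G ^+ 4 * B ^+ 2) (subX 2 (C ^+ 2) * G ^+ 4).
Proof. by rewrite B_sqr mulrC. Qed.

(** The even part of [F3] is [F2 ^ 4 + q * C ^ 4] modulo 8. Here [F2 ^ 4] is
    [G ^ 4], since [F2] is the even part of [G ^ 2], hence is [G] modulo 2; and
    [C ^ 4] is [B ^ 2], both being [h ^ 8]. *)
Lemma even4 : eqm 8 (even_part F3) F2.
Proof.
rewrite /F3 !even_partD even_G8 even_partMnat !even_part_qM.
rewrite middle odd_part_subXM odd_G4.
rewrite (_ : 6%:R * _ = 8%:R * (3%:R * q * C ^+ 2 * (F2 * G ^+ 2 * B)));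
  last by ring.
rewrite kill8 addr0 odd_part_qM B4 even_part_subX /F2.
apply: eqmD => //; apply: eqmM => //.
rewrite (exprM C 2 2) C_sqr; apply/eqm_sym.
exact: (sqr8 B_h4).
Qed.

(** The odd part of [F3] is [6 * C ^ 2 * F3], in which [C ^ 2] is even modulo 4;
    hence the next odd part is [36 * h ^ 2 * C ^ 2 * F3], that is, 4 times a
    series which is even modulo 2. *)
Lemma descent3 : eqm 8 (odd_part (odd_part (odd_part F3))) 0.
Proof.
have odd_F3 : eqm 8 (odd_part F3) (6%:R * (C ^+ 2 * F3)).
  rewrite {1}/F3 !odd_partD odd_G8 odd_partMnat !odd_part_qM.
  rewrite middle even_part_subXM F3E even_part_qM B4 odd_part_subX mulr0.
  by rewrite addr0 add0r.
have lift6 (x y : fps int) : eqm 4 x y -> eqm 8 (6%:R * x) (6%:R * y).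
  by case=> z ->; exists (3%:R * z); ring.
have C2 : eqm 4 (C ^+ 2) (subX 2 (h ^+ 2)).
  rewrite (@eqm_weaken _ 2 4 _ _ C_sqr) (exprM h 2 2) subXX //.
  exact: sqr4.
have F3_mod2 : eqm 2 F3 (subX 2 G).
  rewrite -F3E even_G4 (_ : _ + _ =
    F2 ^+ 2 + 2%:R * (2%:R * q * G ^+ 4 * B ^+ 2)); last by ring.
  by rewrite (eqm0 2 _) addr0 F2_mod2.
have -> : eqm 8 (odd_part F3) (6%:R * (subX 2 (h ^+ 2) * F3)).
  by apply: (eqm_trans odd_F3); apply: lift6; apply: (eqmM C2).
rewrite odd_partMnat odd_part_subXM.
have -> : eqm 8 (6%:R * (h ^+ 2 * odd_part F3)) (4%:R * subX 2 (h * C * G)).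
  rewrite odd_F3.
  rewrite (_ : 6%:R * _ = 4%:R * (h ^+ 2 * C ^+ 2 * F3) +
    8%:R * (4%:R * (h ^+ 2 * C ^+ 2 * F3))); last by ring.
  rewrite kill8 addr0 !subXM //; apply: lift4.
  exact: (eqmM (eqmM h_sqr (frobenius2 C)) F3_mod2).
by rewrite odd_partMnat odd_part_subX mulr0.
Qed.

(** From [k = 2] on, the iterated even parts alternate between [F2] and [F3]. *)
Lemma descent k :
  eqm 8 (odd_part (odd_part (odd_part (iter k (@even_part int) G)))) 0.
Proof.
case: k => [|[|k]]; [exact: descent0 | exact: descent1 |].
suff [| ->] : eqm 8 (iter k.+2 (@even_part int) G) F2 \/
              eqm 8 (iter k.+2 (@even_part int) G) F3.
- by move->; exact: descent2.
- exact: descent3.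
elim: k => [|k [IHk|IHk]]; first by left; rewrite /= even2.
  by right; rewrite iterS IHk even3.
by left; rewrite iterS IHk even4.
Qed.

End Descent.

(** * The generating series as a theta quotient *)

Section Series.
Variable R : comNzRingType.
Local Notation q := (q R).
Local Notation f := (euler_prod R).
Local Notation h := (distinct_prod R).
Local Notation o := (odd_prod R).
Local Notation phi := (theta R).
Local Notation phim := (subN (theta R)).
Local Notation psi := (psi R).

(** Any of the [c] copies of a part can be the designated one. *)
Definition pd_factor : fps R := Fps (fun c => (if c is 0 then 1 else c)%:R).
Definition pd_series := iprod (fun i => subX i.*2.+1 pd_factor).

Lemma pd_factorE : pd_factor * (1 - q) ^+ 2 = 1 - q + q ^+ 2.
Proof.
transitivity (pd_factor - 2%:R * (q * pd_factor) + q ^+ 2 * pd_factor).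
  by ring.
apply: fpsP => n; rewrite !fpsD !fpsN fpsMnat qM qXM qX fps1.
have -> : q n = (n == 1)%:R by [].
case: n => [|[|[|n]]] /=; rewrite ?subn2 /=; ring.
Qed.

Lemma pd_factor_prod :
  pd_factor * ((1 - q) * (1 - q ^+ 2) * (1 - q ^+ 3)) = 1 - q ^+ 6.
Proof.
have := congr1 (fun x => x * ((1 + q) * (1 - q ^+ 3))) pd_factorE.
rewrite (_ : (1 - q + q ^+ 2) * _ = 1 - q ^+ 6); last by ring.
by move=> <-; ring.
Qed.

Lemma multipliable_pd : multipliable (fun i => subX i.*2.+1 pd_factor).
Proof.
move=> i n ni /=; case: n ni => [|n] ni; first by rewrite dvdn0 div0n.
by rewrite ifN //; apply/negP => /dvdn_leq; lia.
Qed.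

Lemma multipliable_odd_subX k : (0 < k)%N ->
  multipliable (fun i => 1 - q ^+ (k * i.*2.+1)).
Proof. by move=> k0 i; rewrite -mulN1r; apply: eq_below_addqX; nia. Qed.

Lemma odd_prod_subX k : (0 < k)%N ->
  subX k o = iprod (fun i => 1 - q ^+ (k * i.*2.+1)).
Proof.
move=> k0; rewrite subX_iprod //; last exact: multipliable_odd.
by apply: eq_iprod => i; rewrite subXD subXN subX1 // subXqX.
Qed.

(** One factor of the product, with [x = q ^ m], is
    [(1 - x ^ 6) / ((1 - x) * (1 - x ^ 2) * (1 - x ^ 3))]. *)
Lemma pd_series_prod : pd_series * (o * subX 2 o * subX 3 o) = subX 6 o.
Proof.
rewrite !odd_prod_subX // /odd_prod.
have c1 := @multipliable_odd R; have c2 := @multipliable_odd_subX 2 isT.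
have c3 := @multipliable_odd_subX 3 isT.
rewrite !iprodM //; try by do ?apply: multipliableM => //;
  apply: multipliable_pd.
apply: eq_iprod => i.
have := congr1 (subX i.*2.+1) pd_factor_prod.
rewrite !subXM // !(subXD, subXN) !subX1 // !subXqX // subXq //.
by rewrite ![(i.*2.+1 * _)%N]mulnC => <-; ring.
Qed.

Lemma pd_theta : pd_series * (subX 2 phim * subX 12 f) = psi * subX 3 psi.
Proof.
have op k : (0 < k)%N -> subX k o * subX k psi = subX (k * 2) f.
  by move=> k0; rewrite -subXM // psi_prod subX_comp.
have of' k : (0 < k)%N -> subX k o * subX (k * 2) f = subX k f.
  by move=> k0; rewrite -subX_comp // -subXM // odd_euler.
apply: (@fps_mulIr _ _ _ (o * subX 2 o * subX 3 o)).
  by rewrite !fpsM0 !subX_coef0 odd_coef0 !mulr1.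
rewrite mulrA [_ * pd_series]mulrC pd_series_prod.
rewrite subN_theta subXM // mulrCA (of' 6) //.
rewrite (_ : o * _ * _ * _ = subX 2 o * (o * psi * (subX 3 o * subX 3 psi)));
  last by ring.
by rewrite psi_prod op //; ring.
Qed.

Let T := phim * subX 6 f.

Let theta_parts : subX 2 T * pd_series =
  subX 2 (subX 2 psi * subX 3 phi) + q * subX 2 (phi * subX 6 psi).
Proof.
rewrite mulrC /T subXM // subX_comp // pd_theta psi_psi3.
by rewrite !subXM // !subX_comp // mulrA.
Qed.

Let T0 : T 0%N = 1.
Proof.
by rewrite /T subN_theta !fpsM0 subX_coef0 odd_coef0 euler_coef0 !mulr1.
Qed.

Lemma phi_odd_prod : phi * o ^+ 2 = subX 2 o ^+ 2 * subX 2 f.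
Proof.
apply: (@fps_mulIr _ _ _ (subX 2 f)); first by rewrite subX_coef0 euler_coef0.
have -> : subX 2 f * (phi * o ^+ 2) = phi * phim by rewrite subN_thetaE; ring.
by rewrite theta_subN subN_theta subXM //; ring.
Qed.

(** By [theta_parts] the even part is [psi (q ^ 2) * phi (q ^ 3) / T], which is
    compared with the square through the product formulas. *)
Lemma even_pd : even_part pd_series = pd_series ^+ 2.
Proof.
apply: (@fps_mulIr _ _ _ T); first exact: T0.
have <- : even_part (subX 2 T * pd_series) = T * even_part pd_series.
  exact: even_part_subXM.
rewrite theta_parts even_partK.
apply: (@fps_mulIr _ _ _ ((o * subX 2 o * subX 3 o) ^+ 2)).
  by rewrite fpsX0 !fpsM0 !subX_coef0 odd_coef0 !mulr1 expr1n.
have -> : (o * subX 2 o * subX 3 o) ^+ 2 * (T * pd_series ^+ 2) =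
  T * subX 6 o ^+ 2.
  by rewrite -pd_series_prod; ring.
rewrite /T subN_thetaE.
have -> : (o * subX 2 o * subX 3 o) ^+ 2 * (subX 2 psi * subX 3 phi) =
   o ^+ 2 * (subX 2 o * (subX 2 o * subX 2 psi) *
     (subX 3 phi * subX 3 o ^+ 2)) by ring.
rewrite -[subX 2 o * subX 2 psi]subXM // psi_prod subX_comp //.
rewrite -[subX 3 o ^+ 2]subXX // -subXM // phi_odd_prod subXM // subXX //.
rewrite !subX_comp //.
have <- : subX 2 o * subX 4 f = subX 2 f.
  by rewrite -[subX 4 f](@subX_comp _ 2 2) // -subXM // odd_euler.
by ring.
Qed.

Lemma odd_pd : odd_part pd_series * T = phi * subX 6 psi.
Proof.
by rewrite mulrC -[LHS](odd_part_subXM _ pd_series) theta_parts odd_partK.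
Qed.

Lemma psiE : psi = h ^+ 2 * f.
Proof.
rewrite expr2 -mulrA distinct_euler -psi_prod mulrA [h * o]mulrC.
by rewrite odd_distinct mul1r.
Qed.

(** The advantage over [odd_pd] is that, up to even factors, only the square of
    [phi] is left, whose parts are explicit. *)
Lemma odd_pdE : subX 2 (phim ^+ 2) * odd_part pd_series =
  phi ^+ 2 * subX 6 (h ^+ 2).
Proof.
apply: (@fps_mulIr _ _ _ (subX 6 f)); first by rewrite subX_coef0 euler_coef0.
rewrite subXX // -theta_subN [in RHS]mulrCA -subXM // [f * _]mulrC -psiE.
rewrite (_ : subX 6 f * _ = phi * (odd_part pd_series * T));
  last by rewrite /T; ring.
by rewrite odd_pd; ring.
Qed.

Lemma phi_sqr : phi ^+ 2 =
  subX 2 (subX 2 phi ^+ 2 + 4%:R * q * subX 4 psi ^+ 2) +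
  q * subX 2 (4%:R * (subX 2 phi * subX 4 psi)).
Proof.
rewrite {1}theta_split !(subXD, subXM, subXX, subXnat, subXq) // !subX_comp //.
by ring.
Qed.

Lemma odd_pd_parts :
  phim ^+ 2 * even_part (odd_part pd_series) =
    (subX 2 phi ^+ 2 + 4%:R * q * subX 4 psi ^+ 2) * subX 3 h ^+ 2 /\
  phim ^+ 2 * odd_part (odd_part pd_series) =
    4%:R * (subX 2 phi * subX 4 psi * subX 3 h ^+ 2).
Proof.
have E : subX 2 (phim ^+ 2) * odd_part pd_series =
    subX 2 ((subX 2 phi ^+ 2 + 4%:R * q * subX 4 psi ^+ 2) * subX 3 h ^+ 2) +
    q * subX 2 (4%:R * (subX 2 phi * subX 4 psi * subX 3 h ^+ 2)).
  rewrite odd_pdE phi_sqr -[6%N]/(2 * 3)%N -subX_comp //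
    -[subX 3 h ^+ 2]subXX //.
  by rewrite !(subXM _ _ (k := 2)) //; ring.
by split; [rewrite -(even_part_subXM (phim ^+ 2)) E even_partK |
           rewrite -(odd_part_subXM (phim ^+ 2)) E odd_partK].
Qed.

End Series.

(** * Congruences for the generating series *)

Section Mod8.
Local Notation f := (euler_prod int).
Local Notation h := (distinct_prod int).
Local Notation phi := (theta int).
Local Notation phim := (subN (theta int)).
Local Notation psi := (psi int).
Local Notation h3 := (subX 3 h).
Local Notation q := (q int).

(** [h * f = f (q ^ 2)], which is [f ^ 2] modulo 2. *)
Lemma distinct_mod2 : eqm 2 h f.
Proof.
apply: (@eqm_cancel _ _ f); first exact: euler_coef0.
by rewrite mulrC distinct_euler -expr2; apply/eqm_sym/frobenius2.
Qed.

Lemma distinct_coef0 : h 0%N = 1.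
Proof. exact: iprod0 (@multipliable_distinct int). Qed.

Lemma thetaN_mod2 : eqm 2 phim 1.
Proof.
apply: (@eqm_cancel _ _ h); first exact: distinct_coef0.
by rewrite theta_prod mulr1; apply/eqm_sym/distinct_mod2.
Qed.

Lemma theta_mod2 : eqm 2 phi 1.
Proof.
have := @theta_subN int => E.
have : eqm 2 (phi * phim) 1.
  by rewrite E thetaN_mod2 subX1 // expr1n.
by rewrite thetaN_mod2 mulr1.
Qed.

Lemma psi_mod2 : eqm 2 psi (h ^+ 3).
Proof.
rewrite psiE [h ^+ 3]exprSr.
exact: eqmM (eqm_refl _ _) (eqm_sym distinct_mod2).
Qed.

Lemma even_odd_pd : eqm 4 (even_part (odd_part (pd_series int))) (h3 ^+ 2).
Proof.
have N4 : eqm 4 (phim ^+ 2) 1.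
  by rewrite -[X in eqm _ _ X](expr1n _ 2); apply: (@eqm_sqr _ 2) thetaN_mod2.
have P4 : eqm 4 (subX 2 phi ^+ 2) 1.
  rewrite -[X in eqm _ _ X](expr1n _ 2); apply: (@eqm_sqr _ 2) => //.
  by rewrite -[X in eqm _ _ X](@subX1 _ 2) //; apply/eqm_subX/theta_mod2.
have [E _] := odd_pd_parts int.
have : eqm 4 (phim ^+ 2 * even_part (odd_part (pd_series int))) (h3 ^+ 2).
  by rewrite E P4 -mulrA (eqm0 4 _) addr0 mul1r.
by rewrite N4 mul1r.
Qed.

Lemma odd_odd_pd : exists D W,
  odd_part (odd_part (pd_series int)) = 4%:R * D /\ eqm 2 D (subX 2 W).
Proof.
have [_ E] := odd_pd_parts int.
have N0 : (phim ^+ 2) 0%N = 1.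
  by rewrite fpsX0 subN_theta fpsM0 odd_coef0 euler_coef0 mul1r expr1n.
have [v Nv] := fps_inv N0.
set w := subX 2 phi * subX 4 psi * h3 ^+ 2 in E.
exists (w * v), (subX 2 psi * h3); split.
  by rewrite mulrA -E mulrAC Nv mul1r.
have v1 : eqm 2 v 1.
  have : eqm 2 (phim ^+ 2 * v) 1 by rewrite Nv.
  by rewrite thetaN_mod2 expr1n mul1r.
have P2 : eqm 2 (subX 2 phi) 1.
  by rewrite -[X in eqm _ _ X](@subX1 _ 2) //; apply/eqm_subX/theta_mod2.
rewrite /w v1 P2 mul1r mulr1 subXM // subX_comp //.
by apply: eqmM => //; apply: frobenius2.
Qed.

(** Modulo 8, [h ^ 4] is [f (q ^ 2) ^ 2 * phi ^ 2], so that its odd part comes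
    from the one of [phi ^ 2]. *)
Lemma odd_h4 : eqm 8 (odd_part (odd_part (h3 ^+ 4))) (4%:R * h3 ^+ 7).
Proof.
have hN : h ^+ 4 * phim ^+ 2 = subX 2 f ^+ 2.
  by rewrite -distinct_euler -theta_prod; ring.
have hE : h ^+ 4 * subX 2 phim ^+ 4 = subX 2 f ^+ 2 * phi ^+ 2.
  rewrite -hN (exprM (subX 2 phim) 2 2) -theta_subN; ring.
have N8 : eqm 8 (subX 2 phim ^+ 4) 1.
  rewrite -[X in eqm _ _ X](expr1n _ 4) !(exprM _ 2 2).
  apply: (@eqm_sqr _ 4) => //; apply: (@eqm_sqr _ 2) => //.
  by rewrite -[X in eqm _ _ X](@subX1 _ 2) //; apply/eqm_subX/thetaN_mod2.
have P2 k : (0 < k)%N -> eqm 2 (subX k phi) 1.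
  move=> k0; rewrite -[X in eqm _ _ X](@subX1 _ k) //.
  by apply/eqm_subX => //; apply: theta_mod2.
have h4 : eqm 8 (h ^+ 4) (subX 2 f ^+ 2 * phi ^+ 2).
  by rewrite -hE N8 mulr1.
have phi3 : subX 3 phi ^+ 2 =
  subX 2 (subX 3 (subX 2 phi ^+ 2 + 4%:R * q * subX 4 psi ^+ 2)) +
  q * subX 2 (4%:R * (q * (subX 6 phi * subX 12 psi))).
  have swap x : subX 3 (subX 2 x) = subX 2 (subX 3 x) :> fps int.
    by rewrite !subX_comp.
  rewrite -subXX // phi_sqr subXD swap [subX 3 (q * _)]subXM // swap subXq //.
  congr (_ + _); rewrite !(subXM, subXnat, subXq) // !subX_comp //.
  by ring.
have h34 : eqm 8 (h3 ^+ 4) (subX 2 (subX 3 f ^+ 2) * subX 3 phi ^+ 2).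
  have := @eqm_subX _ _ 3 _ _ isT h4.
  by rewrite subXX // subXM // !subXX // !subX_comp.
have lift4 (x y : fps int) : eqm 2 x y -> eqm 8 (4%:R * x) (4%:R * y).
  exact: (@eqm_mulr _ 2 4).
have lt : eqm 8 (odd_part (h3 ^+ 4)) (4%:R * (q * subX 2
  (subX 3 f * subX 6 psi))).
  rewrite h34 odd_part_subXM phi3 odd_partK.
  rewrite (_ : _ * _ = 4%:R * (subX 3 f ^+ 2 * (q *
    (subX 6 phi * subX 12 psi)))); last by ring.
  apply: lift4; rewrite P2 // mul1r (frobenius2 (subX 3 f)).
  by rewrite subXM // !subX_comp // mulrCA.
rewrite lt odd_partMnat odd_part_qM even_part_subX; apply: lift4.
have hf3 : eqm 2 (subX 3 f) h3 by apply: eqm_subX => //;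
  apply/eqm_sym/distinct_mod2.
rewrite hf3 -[6%N]/(2 * 3)%N -subX_comp // -(frobenius2 (subX 3 psi)).
have -> : eqm 2 (subX 3 psi) (h3 ^+ 3).
  by rewrite -subXX //; apply: eqm_subX => //; apply: psi_mod2.
by rewrite -exprM -exprS.
Qed.

Lemma pd_series_mod8 k :
  eqm 8 (odd_part (odd_part (odd_part (iter k (@even_part int)
    (pd_series int))))) 0.
Proof.
have [D [W [oddD evenD]]] := odd_odd_pd.
exact: (descent (even_pd int) erefl erefl even_odd_pd oddD evenD odd_h4).
Qed.

End Mod8.

Local Close Scope ring_scope.

(** * Enumeration of the partitions *)

Definition designated_block m c j : seq (nat * bool) :=
  [seq (m, b) | b <- mkseq (fun i => i == j) c].

(** The ways to use the part [m]: [i] is the total size of its copies and [j] the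
    position of the designated one. Without any copy the only choice is
    [j = 0]. *)
Definition choices m n : seq (nat * nat) :=
  [seq (i, j) | i <- [seq i <- iota 0 n.+1 | m %| i],
    j <- iota 0 (maxn 1 (i %/ m))].

Fixpoint pd_list k n : seq (seq (nat * bool)) :=
  if k is k'.+1 then
    if odd k then
      [seq designated_block k (x.1 %/ k) x.2 ++ s | x <- choices k n,
        s <- pd_list k' (n - x.1)]
    else pd_list k' n
  else if n == 0 then [:: [::]] else [::].

Lemma pd_listS k n : pd_list k.+1 n =
  if odd k.+1 then [seq designated_block k.+1 (x.1 %/ k.+1) x.2 ++ s |
                      x <- choices k.+1 n, s <- pd_list k (n - x.1)]
  else pd_list k n.
Proof. by []. Qed.

Definition is_PD2_le k n s := is_PD2 n s && all (leq^~ k) (unzip1 s).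

Lemma choicesP m n i j : 0 < m ->
  reflect [/\ i <= n, m %| i & j < maxn 1 (i %/ m)] ((i, j) \in choices m n).
Proof.
move=> m0; apply: (iffP allpairsPdep) => [[i' [j' []]]|[iN mi ji]].
  by rewrite mem_filter !mem_iota /= => /andP[mi iN] ji [-> ->]; split => //;
    lia.
by exists i, j; rewrite mem_filter !mem_iota mi ji /=; split => //; lia.
Qed.

Lemma unzip1_designated_block m c j : unzip1 (designated_block m c j) = nseq c m.
Proof.
rewrite -[c in RHS](size_mkseq (fun i => i == j)) /designated_block.
by elim: (mkseq _ _) => //= b l ->.
Qed.

Lemma size_designated_block m c j : size (designated_block m c j) = c.
Proof. by rewrite size_map size_mkseq. Qed.

Lemma count_designated_block m c j a :
  count_mem (a, true) (designated_block m c j) = (a == m) && (j < c).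
Proof.
rewrite count_map (eq_count (a2 := fun b => (a == m) && b)); last first.
  by move=> b /=; rewrite -pair_eqE /= eq_sym; case: b; rewrite ?andbF ?andbT.
case: (a == m); last by rewrite /= count_pred0.
rewrite /mkseq count_map /= -[count _ _]/(count_mem j (iota 0 c)).
by rewrite count_uniq_mem ?iota_uniq // mem_iota.
Qed.

(** Applied to the marks of the copies of one part, this recovers the position
    [j] of a block. *)
Lemma bits_one (l : seq bool) : count id l = 1 ->
  l = mkseq (fun i => i == index true l) (size l).
Proof.
elim: l => [|b l IHl] //=; case: b => /=.
  rewrite add1n => -[l0]; rewrite /mkseq /= -[1]addn0 iotaDl -map_comp.
  congr cons; move: l0; elim: l {IHl} => [|[] l IHl] //=.
  rewrite add0n => /IHl {1}->.
  by rewrite (iotaDl 1 0) -map_comp.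
rewrite add0n => /IHl {1}->.
by rewrite /mkseq /= (iotaDl 1 0) -map_comp.
Qed.

(** Parts are listed in decreasing order, so the copies of the largest possible
    part come first. *)
Lemma split_largest m (s : seq (nat * bool)) :
  sorted geq (unzip1 s) -> all (leq^~ m) (unzip1 s) ->
  s = [seq x <- s | x.1 == m] ++ [seq x <- s | x.1 != m].
Proof.
elim: s => [|[a b] s IHs] //= ps /andP[am sm].
have := IHs (path_sorted ps) sm; case: eqP => [-> /= {1}-> //|/eqP am' _] /=.
have sa : all (geq a) (unzip1 s).
  by apply: order_path_min ps => x y z /= yx zy; apply: leq_trans zy yx.
have sne : all (fun x : nat * bool => x.1 != m) s.
  by move: sa; rewrite all_map; apply: sub_all => x /=; lia.
rewrite (all_filterP sne) (_ : [seq x <- s | x.1 == m] = [::]) //.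
apply/eqP; rewrite -(negbK (_ == _)) -has_filter -all_predC.
by apply: sub_all sne => x.
Qed.

Lemma is_PD2_leP k n s :
  reflect ([/\ sorted geq (unzip1 s), 0 \notin unzip1 s, sumn (unzip1 s) = n,
      all (fun a => count_mem (a, true) s == 1) (unzip1 s) &
      all odd (unzip1 s)] /\ all (leq^~ k) (unzip1 s)) (is_PD2_le k n s).
Proof.
rewrite /is_PD2_le /is_PD2 /is_designated_partition /is_partition.
apply: (iffP andP) => [[/andP[/andP[/and3P[? ? /eqP ?] ?] ?] ?] | [[? ? -> ->
  ->] ?]] //.
by rewrite eqxx !andbT; split => //; apply/andP.
Qed.

Lemma count_le k (s : seq (nat * bool)) a b :
  all (leq^~ k) (unzip1 s) -> k < a -> count_mem (a, b) s = 0.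
Proof.
move=> sk ka; apply/count_memPn/negP => /(map_f fst) /(allP sk) /=.
by rewrite leqNgt ka.
Qed.

Lemma geq_trans : transitive geq.
Proof. by move=> x y z /= yx zy; apply: leq_trans zy yx. Qed.

Lemma is_PD2_cons m c j n s : odd m -> (j < maxn 1 c)%N -> 
  is_PD2_le m.-1 n s -> is_PD2_le m (c * m + n) (designated_block m c j ++ s).
Proof.
move=> om ji /is_PD2_leP[[ss s0 sn sc so] sk]; apply/is_PD2_leP.
have m0 : 0 < m by case: m om {sk}.
rewrite /unzip1 map_cat -!/(unzip1 _) unzip1_designated_block; do 2?split.
- move: ss; rewrite !(sorted_pairwise geq_trans) pairwise_cat => ->.
  rewrite andbT; apply/andP; split.
    by apply/allrelP => x y /nseqP[-> _] /(allP sk) /=; lia.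
  by elim: (c) => //= d ->; rewrite andbT; apply/allP => x /nseqP[->] /=.
- by rewrite mem_cat negb_or s0 andbT; apply/negP => /nseqP[]; lia.
- by rewrite sumn_cat sumn_nseq sn mulnC.
- rewrite all_cat; apply/andP; split; apply/allP => a;
  rewrite count_cat count_designated_block.
    move=> /nseqP[-> c0]; rewrite (count_le _ sk) ?eqxx ?addn0; last by lia.
    by rewrite (_ : j < c) //; lia.
  move=> as'; have /= ak := allP sk _ as'; have /eqP -> := allP sc _ as'.
  by rewrite (_ : (a == m) = false) //; lia.
- by rewrite all_cat so andbT; apply/allP => x /nseqP[->].
rewrite all_cat; apply/andP; split; first by apply/allP => x /nseqP[-> _] /=.
by apply: sub_all sk => x /=; lia.
Qed.

Lemma is_PD2_uncons m n s : is_PD2_le m n s -> exists c j s',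
  [/\ s = designated_block m c j ++ s', j < maxn 1 c, c * m <= n &
    is_PD2_le m.-1 (n - c * m) s'].
Proof.
move=> /is_PD2_leP[[ss s0 sn sc so] sk].
have sE := split_largest ss sk.
set s1 := [seq x <- s | x.1 == m] in sE;
  set s2 := [seq x <- s | x.1 != m] in sE.
have m1 : all (fun x => x.1 == m) s1 by apply: filter_all.
have m2 : all (fun x => x.1 != m) s2 by apply: filter_all.
have s1E : s1 = [seq (m, b) | b <- unzip2 s1].
  by elim: (s1) m1 => //= -[a b] l IHl /andP[/= /eqP -> /IHl {1}->].
have c12 a b : count_mem (a, b) s = if a == m then count_mem (a,
  b) s1 else count_mem (a, b) s2.
  rewrite {1}sE count_cat; case: eqP => [->|/eqP am].
    rewrite (_ : count_mem _ s2 = 0) ?addn0 //;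
      apply/count_memPn/negP => /(allP m2).
    by rewrite eqxx.
  rewrite (_ : count_mem _ s1 = 0) //; apply/count_memPn/negP => /(allP m1) /=.
  by rewrite (negPf am).
exists (size s1), (index true (unzip2 s1)), s2.
have s1B : s1 = designated_block m (size s1) (index true (unzip2 s1)) /\
    index true (unzip2 s1) < maxn 1 (size s1).
  case: (posnP (size s1)) => [/size0nil -> //|s1_gt0].
  have ms : m \in unzip1 s.
    rewrite sE /unzip1 map_cat mem_cat -!/(unzip1 _) s1E.
    by case: (s1) s1_gt0 => //= -[a b] l _; rewrite inE eqxx.
  have : count id (unzip2 s1) = 1.
    have /eqP := allP sc _ ms; rewrite c12 eqxx => <-.
    rewrite [in RHS]s1E [in RHS]count_map; apply: eq_count => b /=.
    by rewrite -pair_eqE /= eqxx; case: b.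
  move=> one; split; first by rewrite {1}s1E {1}(bits_one one) size_map.
  rewrite (_ : maxn 1 _ = size (unzip2 s1)); last by rewrite size_map; lia.
  by rewrite index_mem -has_pred1 has_count (eq_count (a2 := id)) ?one // =>
    -[].
have [{}s1B ji] := s1B; have u1 : unzip1 s1 = nseq (size s1) m.
  by rewrite {1}s1B unzip1_designated_block.
have uE : unzip1 s = nseq (size s1) m ++ unzip1 s2.
  by rewrite {1}sE /unzip1 map_cat -!/(unzip1 _) u1.
have nE : n = size s1 * m + sumn (unzip1 s2).
  by rewrite -sn uE sumn_cat sumn_nseq mulnC.
split=> //; [by rewrite -s1B | by lia |].
move: ss s0 so sk; rewrite uE mem_cat negb_or !all_cat.
move=> ss /andP[_ s0] /andP[_ so] /andP[_ sk].
apply/is_PD2_leP; do 2?split => //.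
- by move: ss; rewrite !(sorted_pairwise geq_trans) pairwise_cat => /and3P[].
- by rewrite [in RHS]nE addKn.
- apply/allP => a as2; have := allP sc a; rewrite uE mem_cat as2 orbT c12.
  move=> /(_ isT); case: (a =P m) as2 => // -> /mapP[x /(allP m2) /=].
  by move=> xm mx; rewrite mx eqxx in xm.
apply/allP => a as2; have /= am := allP sk _ as2.
have /mapP[x /(allP m2) /= xm ax] := as2.
by move: xm; rewrite -ax; lia.
Qed.

Lemma mem_pd_list k n s : (s \in pd_list k n) = is_PD2_le k n s.
Proof.
elim: k n s => [|k IHk] n s.
  apply/idP/is_PD2_leP => [|[[_ s0 <- _ _] sk]] /=.
    by case: eqP => // ->; rewrite inE => /eqP ->.
  case: s s0 sk => [|[a b] s] //=; rewrite in_cons negb_or => /andP[a0 _].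
  by case: a a0.
rewrite pd_listS; case: ifP => ok.
  apply/allpairsPdep/idP => [[[i j] [s' []]]|/is_PD2_uncons[c [j [s' [-> jc cn
    s'P]]]]].
    move=> /choicesP-/(_ isT)[iN ki ji]; rewrite IHk /= => s'P ->.
    by have := is_PD2_cons ok ji s'P; rewrite divnK // subnKC.
  exists (c * k.+1, j), s'; rewrite /= IHk mulnK //; split=> //.
  by apply/choicesP; rewrite ?mulnK ?dvdn_mull.
rewrite IHk; apply/is_PD2_leP/is_PD2_leP => -[[? ? ? ? so] sk];
  do 2?split => //.
  by apply: sub_all sk => x /leqW.
apply/allP => a as'; have /= := allP sk _ as'; have := allP so _ as'.
rewrite leq_eqVlt => oa /orP[/eqP ak|//].
by rewrite ak ok in oa.
Qed.

Lemma uniq_pd_list k n : uniq (pd_list k n).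
Proof.
elim: k n => [|k IHk] n; first by rewrite /=; case: ifP.
rewrite pd_listS; case: ifP => // ok.
apply: allpairs_uniq_dep => [||x y].
- apply: allpairs_uniq_dep; rewrite ?filter_uniq ?iota_uniq //.
  + by move=> i _; rewrite iota_uniq.
  + by move=> [i j] [i' j'] _ _ [-> ->].
- by move=> x _; apply: IHk.
move=> /allpairsPdep[[i j] [s [xP sP ->]]] /allpairsPdep[[i' j'] [s' [yP s'P
  ->]]] /= e.
move: xP yP sP s'P => /choicesP-/(_ isT)[_ ki ji] /choicesP-/(_ isT)[_ ki' ji'].
rewrite !mem_pd_list => /is_PD2_leP[_ sk] /is_PD2_leP[_ s'k].
have cnt c d (t : seq (nat * bool)) : all (leq^~ k) (unzip1 t) ->
    count_mem k.+1 (unzip1 (designated_block k.+1 c d ++ t)) = c.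
  move=> tk; rewrite /unzip1 map_cat count_cat -!/(unzip1 _) unzip1_designated_block
    count_nseq /= eqxx mul1n.
  rewrite (_ : count_mem _ _ = 0) ?addn0 //;
    apply/count_memPn/negP => /(allP tk) /=.
  by rewrite ltnn.
have cE : i %/ k.+1 = i' %/ k.+1.
  by rewrite -(cnt (i %/ k.+1) j s) // e cnt.
have iE : i = i' by rewrite -(divnK ki) cE divnK.
subst i'; move: e => /eqP; rewrite eqseq_cat ?size_designated_block // =>
  /andP[/eqP bE /eqP ->].
suff -> : j = j' by [].
case: (posnP (i %/ k.+1)) => [c0|c_gt0]; first by move: ji ji'; rewrite c0; lia.
have jc : j < i %/ k.+1 by lia.
have := congr1 (fun l => (nth (0, false) l j).2) bE.
by rewrite !(nth_map false) ?size_mkseq // !nth_mkseq // eqxx => /esym/eqP.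
Qed.

Local Open Scope ring_scope.

Definition pd_partial k : fps int :=
  \prod_(i < k) if odd i.+1 then subX i.+1 (pd_factor int) else 1.

Lemma size_choices k n (F : nat -> nat) :
  (\sum_(x <- choices k n) F x.1 =
    \sum_(i < n.+1 | k %| i) maxn 1 (i %/ k) * F i)%N.
Proof.
rewrite /choices big_allpairs_dep big_filter -(big_mkord (fun i =>
  k %| i) (fun i => maxn 1 (i %/ k) * F i))%N.
rewrite /index_iota subn0; apply: eq_bigr => i _.
by rewrite /= big_const_seq iter_addn_0 count_predT size_iota mulnC.
Qed.

Lemma size_pd_list k (n : nat) : (size (pd_list k n))%:R = pd_partial k n.
Proof.
elim: k n => [|k IHk] n; first by rewrite /pd_partial big_ord0 /=; case: eqP.
have -> : pd_partial k.+1 =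
    (if odd k.+1 then subX k.+1 (pd_factor int) else 1) * pd_partial k.
  by rewrite /pd_partial big_ord_recr mulrC.
rewrite pd_listS; case: ifP => ok; last by rewrite mul1r IHk.
rewrite size_allpairs_dep sumnE big_map.
rewrite (size_choices _ _ (fun i => size (pd_list k (n - i)%N))).
rewrite fpsM natr_sum big_mkcond; apply: eq_bigr => i _ /=.
case: ifP => ki; last by rewrite mul0r.
rewrite -IHk natrM; congr (_ * _).
by congr _%:R; case: (i %/ k.+1)%N => // c; lia.
Qed.

Lemma pd_partial_below N k : (N <= k)%N ->
  eq_below N (pd_series int) (pd_partial k.*2).
Proof.
move=> Nk; rewrite (_ : pd_partial _ =
  \prod_(i < k) subX i.*2.+1 (pd_factor int)).
  by apply: iprod_below => //; apply: multipliable_pd.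
elim: k {Nk} => [|k IHk]; first by rewrite /pd_partial !big_ord0.
rewrite /pd_partial doubleS !big_ord_recr /= -/(pd_partial _) IHk odd_double /=.
by rewrite mulr1.
Qed.

(** A list for the bound [2 * (n + 1)] on the parts serves all weights up to
    [n]. *)
Lemma PD2_series n : (PD2 n)%:R = pd_series int n.
Proof.
have nn : (n < n.+1)%N by [].
rewrite (pd_partial_below nn nn) -size_pd_list; congr _%:R; apply: esym.
apply: PD2_count; first exact: uniq_pd_list.
move=> s; rewrite mem_pd_list /is_PD2_le andb_idr // => /is_PD2_bounds[_].
by apply: sub_all => x; lia.
Qed.

Lemma iter_even_part a (x : fps int) n :
  iter a (@even_part int) x n = x (2 ^ a * n)%N.
Proof.
elim: a n => [|a IHa] n; first by rewrite mul1n.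
by rewrite iterS even_part_coef IHa expnSr -mul2n mulnA.
Qed.

Local Close Scope ring_scope.

Theorem theorem1p3 (alpha n : nat) : PD2 (2 ^ alpha * (8 * n + 7)) = 0 %[mod 8].
Proof.
have [z zE] := pd_series_mod8 alpha.
have := congr1 (fun x : fps int => x n) zE.
rewrite !odd_part_coef iter_even_part fpsD fpsMnat add0r.
rewrite (_ : n.*2.+1.*2.+1.*2.+1 = 8 * n + 7)%N; last by lia.
rewrite -PD2_series !natz => E.
apply/eqP; rewrite eqn_mod_dvd // subn0; apply/dvdnP.
exists (absz (z n)); move: (PD2 _) (z n) E => p c E; lia.
Qed.
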